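(* Let $g$ be a left-invariant Riemannian metric on $E(1,1)$. Then $g$ has non-trivial (i.e. nonzero) index of symmetry if and only if, up to isometric automorphism, $g=g_\nu$ for some $\nu>0$. Moreover, $i_{\mathfrak s}(E(1,1),g_\nu)=1$ for every $\nu>0$, and the right-invariant Killing field which at the identity is orthogonal to the abelian ideal spanned by $X_1,X_2$ (unique up to scalar multiples) spans the symmetric subspace, that is, the space of Killing fields $Y$ of $(E(1,1),g_\nu)$ with $(\nabla Y)_e=0$.
   Context: Let $M$ be a homogeneous Riemannian manifold with Levi-Civita connection $\nabla$. For $p\in M$ put $$\mathfrak s_p=\{v\in T_pM:\ \text{there is a Killing field } X \text{ on } M \text{ with } X(p)=v \text{ and } (\nabla X)_p=0\}.$$ The index of symmetry $i_{\mathfrak s}(M)$ is $\dim \mathfrak s_p$, which by homogeneity does not depend on $p$. $E(1,1)$, the group of rigid motions of the Minkowski $2$-space, is presented as $\mathbb R^3$ with the multiplication $$(x,y,z)(x',y',z')=(x+e^zx',\,y+e^{-z}y',\,z+z'),$$ with identity $e=(0,0,0)$. A basis of left-invariant fields is $$X_1=e^z\frac{\partial}{\partial x},\qquad X_2=e^{-z}\frac{\partial}{\partial y},\qquad X_3=\frac{\partial}{\partial z}.$$ For $\nu>0$, $g_\nu$ denotes the left-invariant metric represented in the basis $X_1,X_2,X_3$ by the matrix $\mathrm{diag}(1,1,\nu)$. ''Up to isometric automorphism, $g=g_\nu$'' means that there is a Lie group automorphism of $E(1,1)$ which is an isometry from $(E(1,1),g)$ onto $(E(1,1),g_\nu)$.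 *)

(* Defs.v *)
From HB Require Import structures.
From mathcomp Require Import all_boot all_order all_algebra.
From mathcomp Require Import all_classical all_reals all_analysis.
Set Implicit Arguments.
Unset Strict Implicit.
Unset Printing Implicit Defensive.
Import Order.TTheory GRing.Theory Num.Theory.
Import numFieldNormedType.Exports.
Local Open Scope classical_set_scope.
Local Open Scope ring_scope.

(* Riemannian geometry on R^n in its global chart. Points and tangent vectors
   are row vectors, so the differential of a map phi at p sends v to
   v *m jacobian phi p. *)
Section Riemannian.
Variables (R : realType) (n : nat).
Implicit Types (f : 'rV[R]_n -> R) (g h : 'rV[R]_n -> 'M[R]_n).
Implicit Types (X : 'rV[R]_n -> 'rV[R]_n) (p u v : 'rV[R]_n) (i j k : 'I_n).

Definition partial i f p : R := 'D_(delta_mx 0 i) f p.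

Definition iter_partial (s : seq 'I_n) f : 'rV[R]_n -> R := foldr partial f s.

(* C^infinity *)
Definition smooth f : Prop :=
  forall (s : seq 'I_n) p, differentiable (iter_partial s f) p.

Definition smooth_map m (phi : 'rV[R]_n -> 'rV[R]_m) : Prop :=
  forall k : 'I_m, smooth (fun p => phi p 0 k).

(* g p is the Gram matrix of the coordinate fields at p *)
Definition inner g p u v : R := (u *m g p *m v^T) 0 0.

Definition riemannian_metric g : Prop :=
  [/\ forall i j, smooth (fun p => g p i j),
      forall p u v, inner g p u v = inner g p v u
    & forall p v, v != 0 -> 0 < inner g p v v].

(* phi^* h = g *)
Definition isometric_map (phi : 'rV[R]_n -> 'rV[R]_n) g h : Prop :=
  forall p u v,
    inner h (phi p) (u *m jacobian phi p) (v *m jacobian phi p) = inner g p u v.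

(* christoffel g p k i j is Gamma^k_(i j) of the Levi-Civita connection *)
Definition christoffel g p k i j : R :=
  2^-1 * \sum_l invmx (g p) k l *
    (partial i (fun q => g q j l) p + partial j (fun q => g q i l) p
     - partial l (fun q => g q i j) p).

(* row i is the covariant derivative of X along the i-th coordinate field *)
Definition nabla g X p : 'M[R]_n :=
  \matrix_(i, k) (partial i (fun q => X q 0 k) p
                  + \sum_j christoffel g p k i j * X p 0 j).

(* (L_X g)(d_i, d_j) = X(g_ij) - g([X, d_i], d_j) - g(d_i, [X, d_j]) *)
Definition lie_derivative_metric X g p : 'M[R]_n :=
  \matrix_(i, j) \sum_k (X p 0 k * partial k (fun q => g q i j) p
                         + partial i (fun q => X q 0 k) p * g p k j
                         + partial j (fun q => X q 0 k) p * g p i k).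

Definition killing g X : Prop :=
  smooth_map X /\ forall p, lie_derivative_metric X g p = 0.

Definition symmetric_space g p : set 'rV[R]_n :=
  [set v | exists X, [/\ killing g X, X p = v & nabla g X p = 0]].

(* Largest number of linearly independent vectors in S; this is dim S when S
   is a linear subspace. *)
Definition dimension (S : set 'rV[R]_n) : nat :=
  \max_(d < n.+1 | `[< exists B : 'M[R]_(d, n),
                         row_free B /\ forall r, S (row r B) >]) d.

Definition index_of_symmetry g p : nat := dimension (symmetric_space g p).

End Riemannian.

Section E11.
Variable R : realType.
Implicit Types (p q : 'rV[R]_3) (g : 'rV[R]_3 -> 'M[R]_3).

Definition vec3 (a b c : R) : 'rV[R]_3 := \row_(k < 3) [:: a; b; c]`_k.
Definition cx p : R := p 0 0.
Definition cy p : R := p 0 1.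
Definition cz p : R := p 0 2.

Definition e11_mul p q : 'rV[R]_3 :=
  vec3 (cx p + expR (cz p) * cx q) (cy p + expR (- cz p) * cy q) (cz p + cz q).

Definition e11_id : 'rV[R]_3 := vec3 0 0 0.

Definition X1 p : 'rV[R]_3 := vec3 (expR (cz p)) 0 0.
Definition X2 p : 'rV[R]_3 := vec3 0 (expR (- cz p)) 0.
Definition X3 p : 'rV[R]_3 := vec3 0 0 1.

Definition left_invariant_metric g : Prop :=
  forall a, isometric_map (e11_mul a) g g.

Definition right_invariant_field (Y : 'rV[R]_3 -> 'rV[R]_3) : Prop :=
  forall a p, Y (e11_mul p a) = Y p *m jacobian (fun q => e11_mul q a) p.

Definition lie_automorphism (phi : 'rV[R]_3 -> 'rV[R]_3) : Prop :=
  (forall p q, phi (e11_mul p q) = e11_mul (phi p) (phi q)) /\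
  exists psi : 'rV[R]_3 -> 'rV[R]_3,
    [/\ cancel phi psi, cancel psi phi, smooth_map phi & smooth_map psi].

Definition frame p : 'M[R]_3 := \matrix_(i < 3) [:: X1 p; X2 p; X3 p]`_i.

(* the metric with frame p *m g_nu nu p *m (frame p)^T = diag(1, 1, nu) *)
Definition g_nu (nu : R) p : 'M[R]_3 :=
  invmx (frame p) *m diag_mx (vec3 1 1 nu) *m (invmx (frame p))^T.

End E11.

(* Main.v *)
Require Import Defs.
From HB Require Import structures.
From mathcomp Require Import all_boot all_order all_algebra.
From mathcomp Require Import all_classical all_reals all_analysis.
From mathcomp Require Import ring lra.
Import Order.TTheory GRing.Theory Num.Theory.
Import numFieldNormedType.Exports.
Local Open Scope classical_set_scope.
Local Open Scope ring_scope.

(* In the coordinates (x, y, z) a left-invariant metric depends on z only. Let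
   V = X3 + s X1 + t X2 be orthogonal to the abelian ideal, and let g1, k, g2 be
   the Gram coefficients of X1, X2. Along the integral curves of V the Killing
   equations integrate explicitly in z; comparing the coefficients of the
   functions 1, z, e^(2z), e^(-2z), ... that occur shows that every Killing field
   is right-invariant: (a + c x, b - c y, c). For such a field Z, lowering an
   index turns nabla Z into half the exterior derivative of the dual 1-form, and
   it vanishes at p iff k c = 0 and Z p = c V p. So the index of symmetry is 1
   when k = 0, that is when X1 and X2 are orthogonal, and 0 otherwise.

   If k = 0, rescaling x and y and conjugating V to X3 gives an automorphism onto
   some g_nu. Conversely an automorphism maps the coordinate axes of the ideal to
   eigenvectors, with distinct eigenvalues, of the same diagonal map, hence to
   orthogonal directions of g_nu, which forces k = 0. *)

(** * Calculus in the coordinates of R^3 *)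

Lemma ord3P (P : 'I_3 -> Prop) : P 0 -> P 1 -> P 2 -> forall i, P i.
Proof.
move=> P0 P1 P2 [[|[|[|i]]] Hi] //.
- by rewrite (_ : Ordinal Hi = 0) //; apply: val_inj.
- by rewrite (_ : Ordinal Hi = 1) //; apply: val_inj.
- by rewrite (_ : Ordinal Hi = 2) //; apply: val_inj.
Qed.

Lemma sum3 (V : nmodType) (F : 'I_3 -> V) : \sum_i F i = F 0 + F 1 + F 2.
Proof.
rewrite !big_ord_recr big_ord0 /= add0r.
by congr (F _ + F _ + F _); apply: val_inj.
Qed.

Section Coordinates.
Context {R : realType}.
Implicit Types (p v : 'rV[R]_3) (f : 'rV[R]_3 -> R).

Lemma vec3_0 (a b c : R) : vec3 a b c 0 0 = a.
Proof. by rewrite mxE. Qed.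

Lemma vec3_1 (a b c : R) : vec3 a b c 0 1 = b.
Proof. by rewrite mxE. Qed.

Lemma vec3_2 (a b c : R) : vec3 a b c 0 2 = c.
Proof. by rewrite mxE. Qed.

Definition vec3E := (vec3_0, vec3_1, vec3_2).

Lemma vec3_eta p : p = vec3 (p 0 0) (p 0 1) (p 0 2).
Proof. by apply/rowP; elim/ord3P; rewrite vec3E. Qed.

Lemma delta3_0 : delta_mx 0 0 = vec3 1 0 0 :> 'rV[R]_3.
Proof. by apply/rowP; elim/ord3P; rewrite !mxE. Qed.

Lemma delta3_1 : delta_mx 0 1 = vec3 0 1 0 :> 'rV[R]_3.
Proof. by apply/rowP; elim/ord3P; rewrite !mxE. Qed.

Lemma delta3_2 : delta_mx 0 2 = vec3 0 0 1 :> 'rV[R]_3.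
Proof. by apply/rowP; elim/ord3P; rewrite !mxE. Qed.

(** The chain rule for a curve given by its three coordinates: the differential of [f] is linear and
    the velocity splits along the coordinate vectors. It transports partial derivatives to
    coordinates adapted to the metric. *)
Lemma is_derive_curve f (u v w : R -> R) (t u' v' w' : R) :
  differentiable f (vec3 (u t) (v t) (w t)) ->
  is_derive t 1 u u' -> is_derive t 1 v v' -> is_derive t 1 w w' ->
  is_derive t 1 (fun s => f (vec3 (u s) (v s) (w s)))
    (u' * partial 0 f (vec3 (u t) (v t) (w t))
     + v' * partial 1 f (vec3 (u t) (v t) (w t))
     + w' * partial 2 f (vec3 (u t) (v t) (w t))).
Proof.
move=> df du dv dw; pose c s := vec3 (u s) (v s) (w s).
have dc : derivable c t 1.
  apply/derivable_mxP => i; rewrite (ord1 i); elim/ord3P.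
  - by rewrite (_ : (fun _ => _) = u) //; apply/funext => s; rewrite vec3E.
  - by rewrite (_ : (fun _ => _) = v) //; apply/funext => s; rewrite vec3E.
  - by rewrite (_ : (fun _ => _) = w) //; apply/funext => s; rewrite vec3E.
have dcE : 'D_1 c t = vec3 u' v' w'.
  rewrite derive_mx //; apply/rowP; elim/ord3P; rewrite mxE vec3E.
  - rewrite (_ : (fun _ => _) = u); first exact: derive_val.
    by apply/funext => s; rewrite vec3E.
  - rewrite (_ : (fun _ => _) = v); first exact: derive_val.
    by apply/funext => s; rewrite vec3E.
  - rewrite (_ : (fun _ => _) = w); first exact: derive_val.
    by apply/funext => s; rewrite vec3E.
have /derivable1_diffP dc' := dc.
have dfc : differentiable (f \o c) t by apply: differentiable_comp.
apply: DeriveDef; first by apply/derivable1_diffP.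
rewrite (_ : (fun _ => _) = f \o c) // deriveE // diff_comp //= -(deriveE _ dc') dcE.
rewrite /partial !deriveE // -!linearZ -!linearD /=.
congr ('d f _ _); apply/rowP; elim/ord3P.
all: by rewrite delta3_0 delta3_1 delta3_2 !mxE /= !mulr0 ?mulr1 ?addr0 ?add0r.
Qed.

Lemma partial_is_derive_x f (x y z : R) : differentiable f (vec3 x y z) ->
  is_derive x 1 (fun t => f (vec3 t y z)) (partial 0 f (vec3 x y z)).
Proof.
move=> df; apply: is_derive_eq; first exact: (is_derive_curve f id (cst y) (cst z)).
by rewrite mul1r !mul0r !addr0.
Qed.

Lemma partial_is_derive_y f (x y z : R) : differentiable f (vec3 x y z) ->
  is_derive y 1 (fun t => f (vec3 x t z)) (partial 1 f (vec3 x y z)).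
Proof.
move=> df; apply: is_derive_eq; first exact: (is_derive_curve f (cst x) id (cst z)).
by rewrite mul1r !mul0r addr0 add0r.
Qed.

Lemma differentiable_coordwise m (phi : 'rV[R]_3 -> 'rV[R]_m) p :
  (forall j, differentiable (fun q => phi q 0 j) p) -> differentiable phi p.
Proof.
move=> dphi.
rewrite (_ : phi = \sum_j (fun q => phi q 0 j *: delta_mx 0 j)).
  by apply: differentiable_sum => j; apply: differentiableZl.
apply/funext => q; rewrite fct_sumE {1}(row_sum_delta (phi q)).
by apply: eq_bigr => j _.
Qed.

Lemma jacobianE m (phi : 'rV[R]_3 -> 'rV[R]_m) p i j :
  (forall j, differentiable (fun q => phi q 0 j) p) ->
  jacobian phi p i j = partial i (fun q => phi q 0 j) p.
Proof.
move=> dphi; have df := differentiable_coordwise _ _ _ dphi.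
have := deriveEjacobian (delta_mx 0 i) df.
rewrite -rowE => /(congr1 (fun A : 'rV_m => A 0 j)); rewrite mxE => <-.
rewrite derive_mx ?mxE //; exact: diff_derivable.
Qed.

(* Symbolic expressions in the coordinates and e^z, e^-z: this class is stable
   under partial derivatives, which gives smoothness. *)
Inductive expr :=
  | Cst of R | Coord of 'I_3 | Exp | ExpN | Add of expr & expr | Mul of expr & expr.

Fixpoint sem (e : expr) p : R :=
  match e with
  | Cst r => r
  | Coord i => p 0 i
  | Exp => expR (cz p)
  | ExpN => expR (- cz p)
  | Add a b => sem a p + sem b p
  | Mul a b => sem a p * sem b p
  end.

Definition kron (i j : 'I_3) : expr := Cst (i == j)%:R.

Fixpoint diffe (i : 'I_3) (e : expr) : expr :=
  match e with
  | Cst _ => Cst 0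
  | Coord j => kron i j
  | Exp => Mul (kron i 2) Exp
  | ExpN => Mul (Cst (- 1)) (Mul (kron i 2) ExpN)
  | Add a b => Add (diffe i a) (diffe i b)
  | Mul a b => Add (Mul a (diffe i b)) (Mul (diffe i a) b)
  end.

Lemma differentiable_eval (e : expr) (p : 'rV[R]_3) : differentiable (sem e) p.
Proof.
have dexp (s : 'rV[R]_3 -> R) : differentiable s p -> differentiable (expR \o s) p.
  move=> ds; apply: differentiable_comp => //.
  by apply/derivable1_diffP; exact: ex_derive.
elim: e => [r|i| | |a da b db|a da b db] /=.
- exact: differentiable_cst.
- exact: differentiable_coord.
- by apply: dexp; exact: differentiable_coord.
- by apply: dexp; apply: differentiableN; exact: differentiable_coord.
- exact: differentiableD.
- exact: differentiableM.
Qed.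

Lemma partial_coord (i j : 'I_3) (p : 'rV[R]_3) :
  partial i (fun q : 'rV[R]_3 => q 0 j) p = (i == j)%:R.
Proof.
have dp : derivable id p (delta_mx 0 i) by exact: derivable_id.
have : 'D_(delta_mx 0 i) id p = delta_mx 0 i by exact: derive_id.
rewrite derive_mx // => /(congr1 (fun v : 'rV_3 => v 0 j)).
by rewrite !mxE eqxx /= eq_sym.
Qed.

Lemma partial_expR (i : 'I_3) (f : 'rV[R]_3 -> R) (p : 'rV[R]_3) : differentiable f p ->
  partial i (fun q => expR (f q)) p = partial i f p * expR (f p).
Proof.
move=> df; have dexp : differentiable expR (f p).
  by apply/derivable1_diffP; exact: ex_derive.
rewrite /partial deriveE; last exact: (differentiable_comp df dexp).
rewrite (_ : (fun q => expR (f q)) = expR \o f) // diff_comp //= -(deriveE _ df).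
have dE (h : R) : 'd expR (f p) h = h * expR (f p).
  have -> : h = h *: (1 : R) by rewrite /GRing.scale /= mulr1.
  by rewrite linearZ -deriveE // derive_val /GRing.scale /= mulr1.
by rewrite dE.
Qed.

Lemma partial_eval (i : 'I_3) (e : expr) (p : 'rV[R]_3) : partial i (sem e) p = sem (diffe i e) p.
Proof.
elim: e => [r|j| | |a IHa b IHb|a IHa b IHb] /=.
- exact: derive_cst.
- exact: partial_coord.
- by rewrite partial_expR; [rewrite partial_coord|exact: differentiable_coord].
- rewrite partial_expR; last by apply: differentiableN; exact: differentiable_coord.
  rewrite /partial deriveN; last exact/diff_derivable/differentiable_coord.
  by have := partial_coord i 2 p; rewrite /partial => ->; rewrite mulN1r mulNr.
- by rewrite -IHa -IHb; apply: deriveD; exact/diff_derivable/differentiable_eval.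
- rewrite -IHa -IHb /partial [LHS]deriveM; [|exact/diff_derivable/differentiable_eval..].
  by congr (_ + _); rewrite [LHS]mulrC.
Qed.

Lemma iter_partial_eval s (e : expr) : exists e', iter_partial s (sem e) = sem e'.
Proof.
elim: s => [|i s [e' IH]] /=; first by exists e.
exists (diffe i e'); rewrite IH; apply/funext => p; exact: partial_eval.
Qed.

Lemma smooth_eval (e : expr) : smooth (sem e).
Proof.
by move=> s p; have [e' ->] := iter_partial_eval s e; exact: differentiable_eval.
Qed.

Lemma differentiable_vec3_eval e0 e1 e2 p (j : 'I_3) :
  differentiable (fun q => vec3 (sem e0 q) (sem e1 q) (sem e2 q) 0 j) p.
Proof.
move: j; elim/ord3P.
- rewrite (_ : (fun _ => _) = sem e0); first exact: differentiable_eval.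
  by apply/funext => q; rewrite vec3E.
- rewrite (_ : (fun _ => _) = sem e1); first exact: differentiable_eval.
  by apply/funext => q; rewrite vec3E.
- rewrite (_ : (fun _ => _) = sem e2); first exact: differentiable_eval.
  by apply/funext => q; rewrite vec3E.
Qed.

Lemma partial_vec3_eval i e0 e1 e2 p j :
  partial i (fun q => vec3 (sem e0 q) (sem e1 q) (sem e2 q) 0 j) p
  = vec3 (sem (diffe i e0) p) (sem (diffe i e1) p) (sem (diffe i e2) p) 0 j.
Proof.
move: j; elim/ord3P; rewrite vec3E -partial_eval.
- by congr (partial _ _ _); apply/funext => q; rewrite vec3E.
- by congr (partial _ _ _); apply/funext => q; rewrite vec3E.
- by congr (partial _ _ _); apply/funext => q; rewrite vec3E.
Qed.

Lemma jacobian_eval e0 e1 e2 p i j :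
  jacobian (fun q => vec3 (sem e0 q) (sem e1 q) (sem e2 q)) p i j
  = vec3 (sem (diffe i e0) p) (sem (diffe i e1) p) (sem (diffe i e2) p) 0 j.
Proof.
rewrite jacobianE; last by move=> l; exact: differentiable_vec3_eval.
exact: partial_vec3_eval.
Qed.

Lemma smooth_vec3_eval e0 e1 e2 :
  smooth_map (fun q => vec3 (sem e0 q) (sem e1 q) (sem e2 q)).
Proof.
elim/ord3P.
- by rewrite (_ : (fun _ => _) = sem e0); [exact: smooth_eval|apply/funext => q; rewrite vec3E].
- by rewrite (_ : (fun _ => _) = sem e1); [exact: smooth_eval|apply/funext => q; rewrite vec3E].
- by rewrite (_ : (fun _ => _) = sem e2); [exact: smooth_eval|apply/funext => q; rewrite vec3E].
Qed.

End Coordinates.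

(** * Integration of the Killing equations *)

Section KillingEquations.
Context {R : realType}.
Implicit Types (f : R -> R) (x y z : R).

(** Derivatives are carried as data below; two formulas for one function are compared through this
    uniqueness. *)
Lemma is_derive_unique f x d d' :
  is_derive x 1 f d -> is_derive x 1 f d' -> d = d'.
Proof. by move=> [_ <-] [_ <-]. Qed.

Lemma is_derive_expR2 z :
  is_derive z 1 (fun t : R => expR t * expR t) (2 * (expR z * expR z)).
Proof. apply: is_derive_eq; rewrite /GRing.scale /=; ring. Qed.

Lemma is_derive_expRN2 z :
  is_derive z 1 (fun t : R => expR (- t) * expR (- t)) (- 2 * (expR (- z) * expR (- z))).
Proof.
have H : is_derive z 1 (fun t : R => expR (- t)) (expR (- z) * - 1).
  exact: is_derive1_comp.
apply: is_derive_eq; rewrite /GRing.scale /=; ring.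
Qed.

(** * Solving for the dependence on z *)

Section Elimination.
Context (g1 k g2 nu : R).
Hypotheses (g1_gt0 : 0 < g1) (det_gt0 : 0 < g1 * g2 - k ^+ 2) (nu_gt0 : 0 < nu).
Let m := nu / (g1 * g2 - k ^+ 2).

(** The two equations are linear in [az], [bz], and since [e^z e^-z = 1] their determinant is the
    constant [g1 g2 - k^2]. Cramer's rule gives [az] and [bz] as explicit functions of z, which are
    then integrated from 0. *)
Lemma integrate_z (a b az bz : R -> R) (cx cy : R) :
  (forall z, is_derive z 1 a (az z)) -> (forall z, is_derive z 1 b (bz z)) ->
  (forall z, nu * cx + g1 * (expR (- z) * expR (- z)) * az z + k * bz z = 0) ->
  (forall z, nu * cy + k * az z + g2 * (expR z * expR z) * bz z = 0) ->
  forall z, a z = a 0 - m * (g2 * cx / 2 * (expR z * expR z - 1) - k * cy * z)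
    /\ b z = b 0 - m * (g1 * cy / 2 * (1 - expR (- z) * expR (- z)) - k * cx * z).
Proof.
move=> da db E13 E23 z.
have det0 : g1 * g2 - k ^+ 2 != 0 by rewrite gt_eqF.
have Vz t := expRxMexpNx_1 t.
have azE t : az t = - m * (g2 * cx * (expR t * expR t) - k * cy).
  apply: (mulfI det0).
  have -> : (g1 * g2 - k ^+ 2) * az t = g2 * (expR t * expR t) *
      (nu * cx + g1 * (expR (- t) * expR (- t)) * az t + k * bz t)
    - k * (nu * cy + k * az t + g2 * (expR t * expR t) * bz t)
    - g2 * (expR t * expR t) * nu * cx + k * nu * cy.
    transitivity ((g1 * g2 * (expR t * expR (- t)) ^+ 2 - k ^+ 2) * az t); last ring.
    by rewrite Vz expr1n mulr1.
  by rewrite E13 E23 /m; field.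
have bzE t : bz t = - m * (g1 * cy * (expR (- t) * expR (- t)) - k * cx).
  apply: (mulfI det0).
  have -> : (g1 * g2 - k ^+ 2) * bz t = g1 * (expR (- t) * expR (- t)) *
      (nu * cy + k * az t + g2 * (expR t * expR t) * bz t)
    - k * (nu * cx + g1 * (expR (- t) * expR (- t)) * az t + k * bz t)
    - g1 * (expR (- t) * expR (- t)) * nu * cy + k * nu * cx.
    transitivity ((g1 * g2 * (expR t * expR (- t)) ^+ 2 - k ^+ 2) * bz t); last ring.
    by rewrite Vz expr1n mulr1.
  by rewrite E13 E23 /m; field.
have dE := is_derive_expR2; have dF := is_derive_expRN2.
split.
(* [h] is [a] minus a primitive of the right-hand side of [azE], hence constant. *)
- pose h t := a t + (m * (g2 * cx / 2) * (expR t * expR t) + (- m * (k * cy)) * t).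
  suff : h z = h 0 by rewrite /h expR0 => /eqP; rewrite -subr_eq => /eqP <-; ring.
  apply: is_derive_0_is_cst => t.
  by rewrite /h; apply: is_derive_eq; rewrite /GRing.scale /= azE; field.
- pose h t := b t + (m * (- (g1 * cy) / 2) * (expR (- t) * expR (- t)) + (- m * (k * cx)) * t).
  suff : h z = h 0 by rewrite /h oppr0 expR0 => /eqP; rewrite -subr_eq => /eqP <-; field.
  apply: is_derive_0_is_cst => t.
  by rewrite /h; apply: is_derive_eq; rewrite /GRing.scale /= bzE; field.
Qed.

(** Evaluation at [0], [ln 2], [- ln 2] and [2 ln 2] makes the exponentials rational, leaving an
    invertible rational system in [P], [Q L], [S], [T L]. *)
Lemma exp_affine_indep (P Q S T : R) :
  (forall z, P + Q * z + (S + T * z) * (expR (- z) * expR (- z)) = 0) ->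
  [/\ P = 0, Q = 0, S = 0 & T = 0].
Proof.
move=> H; pose L : R := ln 2.
have L0 : L != 0 by rewrite gt_eqF // ln_gt0 // ltr1n.
have e1 : expR L = 2 by rewrite lnK // posrE.
have e1N : expR (- L) = 2^-1 by rewrite expRN e1.
have e2N : expR (- (L + L)) = 4^-1 by rewrite expRN expRD e1; congr (_^-1); ring.
have := H 0; have := H L; have := H (- L); have := H (L + L).
rewrite !opprK oppr0 expR0 e1 e1N e2N !mulrN ![_ * (L + L)]mulrDr => H1 H2 H3 H4.
have P0 : P = 0 by lra.
have QL : Q * L = 0 by lra.
have S0 : S = 0 by lra.
have TL : T * L = 0 by lra.
by move/eqP: QL; move/eqP: TL; rewrite !mulf_eq0 (negbTE L0) !orbF => /eqP -> /eqP ->.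
Qed.

(** The consequences of the xx-equation, with y frozen. Once the z-dependence is explicit, this
    equation is a relation between [1], [z], [e^(-2z)] and [z e^(-2z)], so that four coefficients
    vanish. *)
Lemma killing_half (a b ax bx az bz : R -> R -> R) (c cx cy cxx cxy : R -> R) :
  (forall x z, is_derive x 1 (a ^~ z) (ax x z)) ->
  (forall x z, is_derive x 1 (b ^~ z) (bx x z)) ->
  (forall x z, is_derive z 1 (a x) (az x z)) ->
  (forall x z, is_derive z 1 (b x) (bz x z)) ->
  (forall x, is_derive x 1 cx (cxx x)) ->
  (forall x, is_derive x 1 cy (cxy x)) ->
  (forall x z, nu * cx x + g1 * (expR (- z) * expR (- z)) * az x z + k * bz x z = 0) ->
  (forall x z, nu * cy x + k * az x z + g2 * (expR z * expR z) * bz x z = 0) ->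
  (forall x z, g1 * (expR (- z) * expR (- z)) * (ax x z - c x) + k * bx x z = 0) ->
  forall x, [/\ cxx x = 0, k * cxy x = 0, k * bx x 0 = 0, forall z, ax x z = c x
    & forall z, bx x z = bx x 0 - m * g1 * cxy x / 2 * (1 - expR (- z) * expR (- z))].
Proof.
move=> dxa dxb dza dzb dcx dcy E13 E23 E11 x.
have abE t := integrate_z _ _ _ _ _ _ (dza t) (dzb t) (E13 t) (E23 t).
(* Differentiating in x the formula of [integrate_z] gives the z-dependence of [ax], and below that
   of [bx]; [cx] and [cy] contribute [cxx] and [cxy]. *)
have axE z : ax x z = ax x 0
    - m * (g2 * cxx x / 2 * (expR z * expR z - 1) - k * cxy x * z).
  apply: (is_derive_unique _ _ _ _ (dxa x z)).
  rewrite (_ : a ^~ z = fun t =>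
      a t 0 + ((- m * g2 / 2 * (expR z * expR z - 1)) * cx t + m * k * z * cy t)).
    have dx0 := dxa x 0.
    apply: is_derive_eq; rewrite /GRing.scale /=; ring.
  by apply/funext => t; have [-> _] := abE t z; ring.
have bxE z : bx x z = bx x 0
    - m * (g1 * cxy x / 2 * (1 - expR (- z) * expR (- z)) - k * cxx x * z).
  apply: (is_derive_unique _ _ _ _ (dxb x z)).
  rewrite (_ : b ^~ z = fun t =>
      b t 0 + ((- m * g1 / 2 * (1 - expR (- z) * expR (- z))) * cy t + m * k * z * cx t)).
    have dx0 := dxb x 0.
    apply: is_derive_eq; rewrite /GRing.scale /=; ring.
  by apply/funext => t; have [_ ->] := abE t z; ring.
have m_gt0 : 0 < m by rewrite divr_gt0.
have g2_gt0 : 0 < g2.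
  have : 0 < g1 * g2 by have := sqr_ge0 k; move: det_gt0; lra.
  by rewrite pmulr_rgt0.
have [] := exp_affine_indep
  (- m * g1 * g2 * cxx x / 2 + k * bx x 0 - k * m * g1 * cxy x / 2)
  (m * k ^+ 2 * cxx x)
  (g1 * (ax x 0 - c x) + m * g1 * g2 * cxx x / 2 + k * m * g1 * cxy x / 2)
  (g1 * m * k * cxy x).
  move=> z; have := E11 x z; rewrite axE bxE => E; rewrite -[RHS]E.
  have V := expRxMexpNx_1 z.
  (* The [e^(2z)] in [ax] meets the factor [e^(-2z)] of the equation and lands in the constant
     coefficient. *)
  have V2 : (expR (- z) * expR (- z)) * (expR z * expR z) = 1.
    by rewrite -[RHS]mulr1 -{1}V -V; ring.
  apply/eqP; rewrite -subr_eq0; apply/eqP.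
  transitivity (m * g1 * g2 * cxx x / 2
    * ((expR (- z) * expR (- z)) * (expR z * expR z) - 1)); first by ring.
  by rewrite V2 subrr mulr0.
have nz (u v : R) : 0 < u -> u * v = 0 -> v = 0.
  by move=> u0 /eqP; rewrite mulf_eq0 gt_eqF //= => /eqP.
move=> H1 H2 H3 H4.
have kxy : k * cxy x = 0.
  by apply: (nz (g1 * m)); [rewrite mulr_gt0|rewrite -H4; ring].
have kxx : k * cxx x = 0.
  have : k ^+ 2 * cxx x = 0 by apply: (nz m) => //; rewrite -H2; ring.
  by move/eqP; rewrite mulf_eq0 sqrf_eq0 -mulf_eq0 => /eqP.
(* Multiplying the constant coefficient by [k] turns its other terms into multiples of [k cxx] and
   [k cxy], already zero. This covers [k = 0] as well. *)
have kbx : k * bx x 0 = 0.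
  suff : k * (k * bx x 0) = 0.
    by move/eqP; rewrite !mulf_eq0 orbA orbb -mulf_eq0 => /eqP.
  transitivity (k * (- m * g1 * g2 * cxx x / 2 + k * bx x 0 - k * m * g1 * cxy x / 2)
    + m * g1 * g2 / 2 * (k * cxx x) + k * m * g1 / 2 * (k * cxy x)); first by ring.
  by rewrite H1 kxx kxy; ring.
have xx0 : cxx x = 0.
  apply: (nz (m * g1 * g2 / 2)); first by rewrite !mulr_gt0 // invr_gt0.
  transitivity (- (- m * g1 * g2 * cxx x / 2 + k * bx x 0 - k * m * g1 * cxy x / 2) + k * bx x 0
     - m * g1 / 2 * (k * cxy x)); first by ring.
  by rewrite H1 kbx kxy; ring.
have ax0 : ax x 0 = c x.
  apply/eqP; rewrite -subr_eq0; apply/eqP; apply: (nz g1) => //; rewrite -[RHS]H3 xx0.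
  transitivity (g1 * (ax x 0 - c x) + m * g1 / 2 * (k * cxy x)); last by ring.
  by rewrite kxy mulr0 addr0.
split=> // z; first by rewrite axE xx0 kxy ax0; ring.
by rewrite bxE kxx; ring.
Qed.

End Elimination.

Lemma exp_indep3 (P Q S : R) :
  (forall z, P * (expR z * expR z) + Q + S * (expR (- z) * expR (- z)) = 0) ->
  P = 0 /\ S = 0.
Proof.
move=> H; have e1 : expR (ln 2) = 2 :> R by rewrite lnK // posrE.
have e1N : expR (- ln 2) = 2^-1 :> R by rewrite expRN e1.
have := H 0; have := H (ln 2); have := H (- ln 2).
by rewrite opprK oppr0 expR0 e1 e1N => H1 H2 H3; split; lra.
Qed.

(* Expanding [c] in [x], the equation [d_y A = mu * d_y d_x c] compares a
   quadratic polynomial in [x] with a constant; the commutation of partial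
   derivatives is not needed. *)
Lemma cross_derivative (mu : R) (A c cx Ay cy cyx : R -> R -> R) :
  (forall x y, is_derive x 1 (A ^~ y) (c x y)) ->
  (forall x y, is_derive y 1 (A x) (Ay x y)) ->
  (forall x y, is_derive x 1 (c ^~ y) (cx x y)) ->
  (forall x y, is_derive y 1 (c x) (cy x y)) ->
  (forall x y, is_derive x 1 (cx ^~ y) 0) ->
  (forall x y, is_derive y 1 (cx x) (cyx x y)) ->
  (forall x y, Ay x y = mu * cyx x y) ->
  forall x y, cy x y = 0.
Proof.
move=> dxA dyA dxc dyc dxcx dycx AyE x0 y.
have cxE x t : cx x t = cx x0 t.
  by exact: (@is_derive_0_is_cst _ (cx ^~ t)).
have cE x t : c x t = c x0 t + (x - x0) * cx x0 t.
  pose h s := c s t - s * cx x0 t.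
  suff : h x = h x0 by rewrite /h => /eqP; rewrite subr_eq => /eqP ->; ring.
  apply: is_derive_0_is_cst => s; have := dxc s t => ds.
  rewrite /h; apply: is_derive_eq; rewrite /GRing.scale /= cxE; ring.
have AE x t : A x t = A x0 t + ((x - x0) * c x0 t + ((x - x0) ^+ 2 / 2) * cx x0 t).
  pose h s := A s t + ((- c x0 t) * s + - (cx x0 t / 2) * ((s - x0) * (s - x0))).
  suff : h x = h x0.
    by rewrite /h subrr => /eqP; rewrite -subr_eq => /eqP <-; field.
  apply: is_derive_0_is_cst => s; have := dxA s t => ds.
  rewrite /h; apply: is_derive_eq; rewrite /GRing.scale /= cE.
  by field.
have cyxE x t : cyx x t = cyx x0 t.
  apply: (is_derive_unique _ _ _ _ (dycx x t)).
  by rewrite (_ : cx x = cx x0) //; apply/funext => s; rewrite cxE.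
(* The y-derivative of the expansion [AE]. *)
have AyxE x : Ay x y = Ay x0 y + ((x - x0) * cy x0 y + ((x - x0) ^+ 2 / 2) * cyx x0 y).
  apply: (is_derive_unique _ _ _ _ (dyA x y)).
  have d1 := dyA x0 y; have d2 := dyc x0 y; have d3 := dycx x0 y.
  rewrite (_ : A x = fun t => A x0 t + ((x - x0) * c x0 t + ((x - x0) ^+ 2 / 2) * cx x0 t)).
    by apply: is_derive_eq; rewrite /GRing.scale /=; ring.
  by apply/funext => t; rewrite AE.
(* The values at [x0 + 1] and [x0 - 1] agree on the left, so their difference isolates the linear
   coefficient [cy x0 y]. *)
have := AyxE (x0 + 1); have := AyxE (x0 - 1).
rewrite !AyE !(cyxE (x0 + 1)) !(cyxE (x0 - 1)) => H1 H2.
have E1 : x0 + 1 - x0 = 1 by ring.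
have E2 : x0 - 1 - x0 = - 1 by ring.
by move: H1 H2; rewrite E1 E2 sqrrN expr1n; lra.
Qed.

(* The Killing equations of [a d/dx + b d/dy + c V], in coordinates where
   [V = d/dz]; [cyx] is [d_y cx] and [cxy] is [d_x cy]. *)
Lemma killing_rigidity (g1 k g2 nu : R)
    (a b ax ay az bx b_y bz : R -> R -> R -> R) (c cx cy cxx cyx cxy cyy : R -> R -> R) :
  0 < g1 -> 0 < g1 * g2 - k ^+ 2 -> 0 < nu ->
  (forall x y z, is_derive x 1 (fun t => a t y z) (ax x y z)) ->
  (forall x y z, is_derive y 1 (fun t => a x t z) (ay x y z)) ->
  (forall x y z, is_derive z 1 (a x y) (az x y z)) ->
  (forall x y z, is_derive x 1 (fun t => b t y z) (bx x y z)) ->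
  (forall x y z, is_derive y 1 (fun t => b x t z) (b_y x y z)) ->
  (forall x y z, is_derive z 1 (b x y) (bz x y z)) ->
  (forall x y, is_derive x 1 (c ^~ y) (cx x y)) ->
  (forall x y, is_derive y 1 (c x) (cy x y)) ->
  (forall x y, is_derive x 1 (cx ^~ y) (cxx x y)) ->
  (forall x y, is_derive y 1 (cx x) (cyx x y)) ->
  (forall x y, is_derive x 1 (cy ^~ y) (cxy x y)) ->
  (forall x y, is_derive y 1 (cy x) (cyy x y)) ->
  (forall x y z,
    nu * cx x y + g1 * (expR (- z) * expR (- z)) * az x y z + k * bz x y z = 0) ->
  (forall x y z,
    nu * cy x y + k * az x y z + g2 * (expR z * expR z) * bz x y z = 0) ->
  (forall x y z,
    g1 * (expR (- z) * expR (- z)) * (ax x y z - c x y) + k * bx x y z = 0) ->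
  (forall x y z,
    g2 * (expR z * expR z) * (b_y x y z + c x y) + k * ay x y z = 0) ->
  (forall x y z, k * (ax x y z + b_y x y z) + g2 * (expR z * expR z) * bx x y z
    + g1 * (expR (- z) * expR (- z)) * ay x y z = 0) ->
  forall x y z, [/\ c x y = c 0 0, a x y z = a 0 0 0 + c 0 0 * x
    & b x y z = b 0 0 0 - c 0 0 * y].
Proof.
move=> g1_gt0 det_gt0 nu_gt0 dxa dya dza dxb dyb dzb dxc dyc dxcx dycx dxcy dycy.
move=> E13 E23 E11 E22 E12.
have g2_gt0 : 0 < g2.
  have : 0 < g1 * g2 by have := sqr_ge0 k; lra.
  by rewrite pmulr_rgt0.
have det'_gt0 : 0 < g2 * g1 - k ^+ 2 by rewrite [g2 * g1]mulrC.
set m := nu / (g1 * g2 - k ^+ 2).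
have m_gt0 : 0 < m by rewrite divr_gt0.
have H1 x y := killing_half g1 k g2 nu g1_gt0 det_gt0 nu_gt0
  (fun x => a x y) (fun x => b x y) (fun x => ax x y) (fun x => bx x y)
  (fun x => az x y) (fun x => bz x y) (c ^~ y) (cx ^~ y) (cy ^~ y) (cxx ^~ y) (cxy ^~ y)
  (fun x => dxa x y) (fun x => dxb x y) (fun x => dza x y) (fun x => dzb x y)
  (dxcx ^~ y) (dxcy ^~ y) (fun x => E13 x y) (fun x => E23 x y) (fun x => E11 x y) x.
have dN (f : R -> R) (z d : R) : is_derive (- z) 1 f d -> is_derive z 1 (fun t => f (- t)) (- d).
  by move=> df; rewrite -[- d]mulrN1; exact: is_derive1_comp.
have dO (f : R -> R) (t d : R) : is_derive t 1 f d -> is_derive t 1 (fun s => - f s) (- d).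
  by move=> df; exact: is_deriveN.
(* (x, y, z) |-> (y, x, - z) exchanges the two halves of the system *)
have H2 x y := killing_half g2 k g1 nu g2_gt0 det'_gt0 nu_gt0
  (fun y z => b x y (- z)) (fun y z => a x y (- z))
  (fun y z => b_y x y (- z)) (fun y z => ay x y (- z))
  (fun y z => - bz x y (- z)) (fun y z => - az x y (- z))
  (fun y => - c x y) (fun y => - cy x y) (fun y => - cx x y)
  (fun y => - cyy x y) (fun y => - cyx x y).
have {}H2 x y : [/\ cyy x y = 0, k * cyx x y = 0, k * ay x y 0 = 0,
    forall z, b_y x y z = - c x y
  & forall z, ay x y z = ay x y 0 + m * g2 * cyx x y / 2 * (1 - expR z * expR z)].
  have F13 y' z : nu * - cy x y' + g2 * (expR (- z) * expR (- z)) * - bz x y' (- z)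
      + k * - az x y' (- z) = 0.
    by rewrite -[RHS]oppr0 -(E23 x y' (- z)); ring.
  have F23 y' z : nu * - cx x y' + k * - bz x y' (- z)
      + g1 * (expR z * expR z) * - az x y' (- z) = 0.
    by rewrite -[RHS]oppr0 -(E13 x y' (- z)) opprK; ring.
  have F11 y' z : g2 * (expR (- z) * expR (- z)) * (b_y x y' (- z) - - c x y')
      + k * ay x y' (- z) = 0.
    by rewrite opprK; exact: E22.
  have [h1 h2 h3 h4 h5] := H2 x y (fun y' z => dyb x y' (- z)) (fun y' z => dya x y' (- z))
    (fun y' z => dN _ _ _ (dzb x y' (- z))) (fun y' z => dN _ _ _ (dza x y' (- z)))
    (fun y' => dO _ _ _ (dycy x y')) (fun y' => dO _ _ _ (dycx x y')) F13 F23 F11 y.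
  split.
  - by apply: oppr_inj; rewrite oppr0.
  - by apply: oppr_inj; rewrite oppr0 -mulrN.
  - by move: h3; rewrite oppr0.
  - by move=> z; have := h4 (- z); rewrite opprK.
  - move=> z; have := h5 (- z); rewrite !opprK oppr0 => ->.
    by rewrite /m [g2 * g1]mulrC; ring.
have nz (u v : R) : 0 < u -> u * v = 0 -> v = 0.
  by move=> u0 /eqP; rewrite mulf_eq0 gt_eqF //= => /eqP.
have H3 x y : bx x y 0 = m * g1 / 2 * cxy x y /\ ay x y 0 = - (m * g2 / 2) * cyx x y.
  have [_ _ _ axE bxE] := H1 x y; have [_ _ _ byE ayE] := H2 x y.
  (* The xy-equation: its [k]-term vanishes because [ax = c] and [b_y = - c], and what remains is a
     combination of [e^(2z)], [1] and [e^(-2z)]. *)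
  have [|h1 h2] := exp_indep3 (g2 * (bx x y 0 - m * g1 / 2 * cxy x y))
    (m * g1 * g2 / 2 * (cxy x y - cyx x y)) (g1 * (ay x y 0 + m * g2 / 2 * cyx x y)).
    move=> z; have E := E12 x y z; rewrite axE byE bxE ayE in E.
    have V := expRxMexpNx_1 z.
    rewrite -[RHS]E; apply/eqP; rewrite -subr_eq0; apply/eqP.
    transitivity (m * g1 * g2 / 2 * (cxy x y - cyx x y) * (1 - (expR z * expR (- z)) ^+ 2)).
      by rewrite /m; ring.
    by rewrite V expr1n subrr mulr0.
  by split; [have := nz _ _ g2_gt0 h1|have := nz _ _ g1_gt0 h2]; lra.
have cy0 : forall x y, cy x y = 0.
  (* At [z = 0] one has [d_x a = c], while [H3] makes [d_y a] a multiple of [cyx]. *)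
  apply: (cross_derivative (- (m * g2 / 2)) (fun x y => a x y 0) c cx
    (fun x y => ay x y 0) cy cyx) => //.
  - by move=> x y; have [_ _ _ h _] := H1 x y; rewrite -(h 0); exact: dxa.
  - by move=> x y; have [h _ _ _ _] := H1 x y; have := dxcx x y; rewrite h.
  - by move=> x y; have [] := H3 x y.
have cx0 : forall x y, cx x y = 0.
  (* The same argument with x and y exchanged; the sign comes from [b_y = - c]. *)
  move=> x y; apply: (cross_derivative (- (m * g1 / 2)) (fun y x => - b x y 0) (fun y x => c x y)
    (fun y x => cy x y) (fun y x => - bx x y 0) (fun y x => cx x y) (fun y x => cxy x y)) => //.
  - move=> s t; have [_ _ _ h _] := H2 t s; rewrite -[c t s]opprK -(h 0).
    by have := dyb t s 0 => d; exact: is_deriveN.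
  - by move=> s t; have [h _ _ _ _] := H2 t s; have := dycy t s; rewrite h.
  - by move=> s t; have [-> _] := H3 t s; ring.
have cxy0 x y : cxy x y = 0.
  apply: (is_derive_unique _ _ _ _ (dxcy x y)).
  by rewrite (_ : cy ^~ y = cst 0); [exact: is_derive_cst|apply/funext => t; rewrite cy0].
have cyx0 x y : cyx x y = 0.
  apply: (is_derive_unique _ _ _ _ (dycx x y)).
  by rewrite (_ : cx x = cst 0); [exact: is_derive_cst|apply/funext => t; rewrite cx0].
have cE x y : c x y = c 0 0.
  transitivity (c 0 y).
    by apply: (@is_derive_0_is_cst _ (c ^~ y)) => t; have := dxc t y; rewrite cx0.
  by apply: is_derive_0_is_cst => t; have := dyc 0 t; rewrite cy0.
have zE x y z : a x y z = a x y 0 /\ b x y z = b x y 0.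
  have [] := integrate_z g1 k g2 nu det_gt0 _ _ _ _ _ _ (dza x y) (dzb x y) (E13 x y) (E23 x y) z.
  by rewrite cx0 cy0 => -> ->; split; ring.
have ay0 x y : ay x y 0 = 0 by have [_ ->] := H3 x y; rewrite cyx0 mulr0.
have bx0 x y : bx x y 0 = 0 by have [-> _] := H3 x y; rewrite cxy0 mulr0.
move=> x y z; split; first exact: cE.
- have [-> _] := zE x y z; transitivity (a x 0 0).
    by apply: (@is_derive_0_is_cst _ (fun t => a x t 0)) => t; have := dya x t 0; rewrite ay0.
  pose h t := a t 0 0 - c 0 0 * t.
  suff : h x = h 0 by rewrite /h => /eqP; rewrite subr_eq => /eqP ->; ring.
  apply: is_derive_0_is_cst => t; have := dxa t 0 0 => d.
  rewrite /h; apply: is_derive_eq; rewrite /GRing.scale /=.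
  by have [_ _ _ -> _] := H1 t 0; rewrite cE; ring.
- have [_ ->] := zE x y z; transitivity (b 0 y 0).
    by apply: (@is_derive_0_is_cst _ (fun t => b t y 0)) => t; have := dxb t y 0; rewrite bx0.
  pose h t := b 0 t 0 + c 0 0 * t.
  suff : h y = h 0 by rewrite /h => /eqP; rewrite -subr_eq => /eqP <-; ring.
  apply: is_derive_0_is_cst => t; have := dyb 0 t 0 => d.
  rewrite /h; apply: is_derive_eq; rewrite /GRing.scale /=.
  by have [_ _ _ -> _] := H2 0 t; rewrite cE; ring.
Qed.

End KillingEquations.

(** * Killing fields of a left-invariant metric *)

Section Nabla.
Context {R : realType} (n : nat).
Implicit Types (g : 'rV[R]_n -> 'M[R]_n) (X : 'rV[R]_n -> 'rV[R]_n) (p : 'rV[R]_n).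

(** Multiplication by [g p] cancels the inverse metric in the Christoffel symbols, leaving those of
    the first kind, which are free of [invmx]. *)
Lemma nabla_lower g X p : (g p)^T = g p -> g p \in unitmx ->
  nabla g X p *m g p = \matrix_(i, l)
    (\sum_k partial i (fun q => X q 0 k) p * g p k l
     + \sum_j 2^-1 * (partial i (fun q => g q j l) p + partial j (fun q => g q i l) p
         - partial l (fun q => g q i j) p) * X p 0 j).
Proof.
move=> gT gU; apply/matrixP => i l; rewrite !mxE.
under eq_bigr => k _ do rewrite mxE mulrDl.
rewrite big_split /=; congr (_ + _).
under eq_bigr => k _ do rewrite mulr_suml.
rewrite exchange_big /=; apply: eq_bigr => j _.
rewrite /christoffel.
pose C l' := partial i (fun q => g q j l') p + partial j (fun q => g q i l') p
         - partial l' (fun q => g q i j) p.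
transitivity (2^-1 * X p 0 j * \sum_l' (\sum_k g p l k * invmx (g p) k l') * C l').
  rewrite mulr_sumr; under [RHS]eq_bigr => l' _ do rewrite mulr_suml mulr_sumr.
  rewrite [RHS]exchange_big /=; apply: eq_bigr => k _.
  rewrite mulr_sumr !mulr_suml; apply: eq_bigr => l' _.
  by rewrite -[in g p k l]gT mxE /C; ring.
have gV l' : \sum_k g p l k * invmx (g p) k l' = (l == l')%:R.
  by have := congr1 (fun A : 'M[R]_n => A l l') (mulmxV gU); rewrite !mxE.
rewrite (bigD1 l) //= gV eqxx big1 => [|l' nl]; first by rewrite mul1r addr0 /C; ring.
by rewrite gV eq_sym (negbTE nl) mul0r.
Qed.

Lemma riemannian_sym g p : riemannian_metric g -> (g p)^T = g p.
Proof.
case=> _ gS _; apply/matrixP => i j; have := gS p (delta_mx 0 j) (delta_mx 0 i).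
by rewrite /inner -!rowE !trmx_delta -!colE !mxE.
Qed.

(** A row of the kernel of [g p] has squared length zero, hence is zero. *)
Lemma riemannian_unitmx g p : riemannian_metric g -> g p \in unitmx.
Proof.
case=> _ _ gP; rewrite -row_free_unit -kermx_eq0; apply/eqP/row_matrixP => i.
apply/eqP; rewrite row0; apply/negPn/negP => /(gP p).
have : row i (kermx (g p)) *m g p = 0.
  by apply/sub_kermxP; exact: row_sub.
by rewrite /inner => ->; rewrite mul0mx mxE ltxx.
Qed.

End Nabla.

(** * Left-invariant metrics adapted to the orthogonal field V *)

Section LeftInvariant.
Context {R : realType}.
Implicit Types (p : 'rV[R]_3).

Lemma inner3 (g : 'rV[R]_3 -> 'M[R]_3) p u v : inner g p u v =
  u 0 0 * (g p 0 0 * v 0 0 + g p 0 1 * v 0 1 + g p 0 2 * v 0 2)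
  + u 0 1 * (g p 1 0 * v 0 0 + g p 1 1 * v 0 1 + g p 1 2 * v 0 2)
  + u 0 2 * (g p 2 0 * v 0 0 + g p 2 1 * v 0 1 + g p 2 2 * v 0 2).
Proof. by rewrite /inner mxE sum3 !mxE !sum3; ring. Qed.

Definition table (T : Type) (d : T) (s : seq (seq T)) (i j : 'I_3) : T :=
  nth d (nth [::] s i) j.

Section Metric.
Context (g1 k g2 s t nu : R).

(* [s] and [t] are such that [X3 + s X1 + t X2] is orthogonal to [X1] and [X2];
   [nu] is its squared length. *)
Definition left_metric_entry : 'I_3 -> 'I_3 -> @expr R :=
  let g13 := Mul (Cst (- (s * g1 + t * k))) ExpN in
  let g23 := Mul (Cst (- (s * k + t * g2))) Exp in
  table _ (Cst 0)
  [:: [:: Mul (Cst g1) (Mul ExpN ExpN); Cst k; g13];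
      [:: Cst k; Mul (Cst g2) (Mul Exp Exp); g23];
      [:: g13; g23; Cst (nu + s ^+ 2 * g1 + 2 * s * t * k + t ^+ 2 * g2)]].

Definition left_metric p : 'M[R]_3 := \matrix_(i, j) sem (left_metric_entry i j) p.

Lemma partial_left_metric i j l p :
  partial l (fun q => left_metric q i j) p = sem (diffe l (left_metric_entry i j)) p.
Proof.
by rewrite -partial_eval; congr (partial _ _ _); apply/funext => q; rewrite mxE.
Qed.

(** The generator of left translations with value [(a, b, c)] at the identity. Writing it with [sem]
    makes smoothness and partial derivatives symbolic. *)
Definition right_field (a b c : R) p : 'rV[R]_3 :=
  vec3 (sem (Add (Cst a) (Mul (Cst c) (Coord 0))) p)
    (sem (Add (Cst b) (Mul (Cst (- c)) (Coord 1))) p) (sem (Cst c) p).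

Lemma partial_right_field a b c p i j :
  partial i (fun q => right_field a b c q 0 j) p
  = vec3 c 0 0 0 j *+ (i == 0) + vec3 0 (- c) 0 0 j *+ (i == 1).
Proof.
rewrite partial_vec3_eval; move: i j; do 2 elim/ord3P; rewrite !vec3E /=; ring.
Qed.

Lemma killing_right_field a b c : killing left_metric (right_field a b c).
Proof.
split; first exact: smooth_vec3_eval.
move=> p; apply/matrixP => i j; rewrite !mxE sum3 !partial_left_metric !partial_right_field.
move: i j; do 2 elim/ord3P; rewrite !vec3E !mxE /=.
all: ring.
Qed.

(** This is [V = X3 + s X1 + t X2]. *)
Definition orth_field p : 'rV[R]_3 := vec3 (s * expR (cz p)) (t * expR (- cz p)) 1.

Hypotheses (g1_gt0 : 0 < g1) (det_gt0 : 0 < g1 * g2 - k ^+ 2) (nu_gt0 : 0 < nu).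

Lemma expR_neq0 (z : R) : expR z != 0.
Proof. by rewrite gt_eqF ?expR_gt0. Qed.

(** [al w], [be w] and [w 0 2] are the components of [w] in the frame [X1], [X2], V, whose Gram
    matrix is constant with V orthogonal to the other two. *)
Lemma inner_left_metric p u v :
  let al (w : 'rV[R]_3) := expR (- cz p) * w 0 0 - s * w 0 2 in
  let be (w : 'rV[R]_3) := expR (cz p) * w 0 1 - t * w 0 2 in
  inner left_metric p u v = g1 * al u * al v + k * (al u * be v + be u * al v)
    + g2 * be u * be v + nu * u 0 2 * v 0 2.
Proof.
have E0 := expR_neq0 (cz p).
by rewrite inner3 !mxE /= expRN; field.
Qed.

Lemma riemannian_left_metric : riemannian_metric left_metric.
Proof.
split.
- move=> i j; rewrite (_ : (fun _ => _) = sem (left_metric_entry i j)); first exact: smooth_eval.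
  by apply/funext => p; rewrite mxE.
- by move=> p u v; rewrite !inner_left_metric; ring.
- move=> p v; apply: contraNT; rewrite -leNgt inner_left_metric.
  set al := expR (- cz p) * _ - _; set be := expR (cz p) * _ - _ => le0.
  (* Completing the square in [g1] times the squared length. *)
  have sq : (g1 * al + k * be) ^+ 2 + (g1 * g2 - k ^+ 2) * be ^+ 2
      + g1 * nu * v 0 2 ^+ 2 <= 0.
    have -> : (g1 * al + k * be) ^+ 2 + (g1 * g2 - k ^+ 2) * be ^+ 2 + g1 * nu * v 0 2 ^+ 2
      = g1 * (g1 * al * al + k * (al * be + be * al) + g2 * be * be + nu * v 0 2 * v 0 2).
      by ring.
    by rewrite pmulr_rle0.
  have h1 := sqr_ge0 (g1 * al + k * be).
  have h2 : 0 <= (g1 * g2 - k ^+ 2) * be ^+ 2 by rewrite mulr_ge0 ?sqr_ge0 // ltW.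
  have h3 : 0 <= g1 * nu * v 0 2 ^+ 2 by rewrite mulr_ge0 ?sqr_ge0 // mulr_ge0 // ltW.
  have v2 : v 0 2 = 0.
    have : g1 * nu * v 0 2 ^+ 2 = 0 by lra.
    by move/eqP; rewrite !mulf_eq0 orbb (gt_eqF g1_gt0) (gt_eqF nu_gt0) => /eqP.
  have be0 : be = 0.
    have : (g1 * g2 - k ^+ 2) * be ^+ 2 = 0 by lra.
    by move/eqP; rewrite mulf_eq0 sqrf_eq0 (gt_eqF det_gt0) => /eqP.
  have al0 : al = 0.
    have : (g1 * al + k * be) ^+ 2 = 0 by lra.
    by move/eqP; rewrite be0 mulr0 addr0 sqrf_eq0 mulf_eq0 (gt_eqF g1_gt0) => /eqP.
  move: al0 be0; rewrite /al /be v2 !mulr0 !subr0 => /eqP + /eqP.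
  rewrite !mulf_eq0 !(negbTE (expR_neq0 _)) /= => /eqP v0 /eqP v1.
  by apply/eqP/rowP; elim/ord3P; rewrite mxE.
Qed.

(** The matrix is skew, as for every Killing field. The brackets in [n2] and [n3] are the [X1]- and
    [X2]-components of [Z - c V], where [Z] is the field. *)
Lemma nabla_right_field a b c p :
  let n1 := k * c in
  let n2 := g1 * expR (- cz p) * (expR (- cz p) * (a + c * cx p) - s * c)
    - t * expR (- cz p) * n1 in
  let n3 := g2 * expR (cz p) * (expR (cz p) * (b - c * cy p) - t * c)
    - s * expR (cz p) * n1 in
  nabla left_metric (right_field a b c) p *m left_metric p =
  \matrix_(i, j) table _ 0
    [:: [:: 0; n1; n2]; [:: - n1; 0; - n3]; [:: - n2; n3; 0]] i j.
Proof.
have rm := riemannian_left_metric.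
rewrite /= nabla_lower; [|exact: riemannian_sym|exact: riemannian_unitmx].
apply/matrixP => i j; rewrite !mxE !sum3 !partial_left_metric !partial_right_field.
move: i j; do 2 elim/ord3P; rewrite !vec3E !mxE /table /= /cx /cy.
all: by field.
Qed.

(** The metric is invertible, so the lowered matrix can be tested instead. Once [n1 = k c] vanishes,
    [n2] and [n3] vanish exactly when [Z - c V] has no component along the ideal, as [g1] and [g2]
    are positive. *)
Lemma nabla_right_field_eq0 a b c p :
  nabla left_metric (right_field a b c) p = 0 <->
  k * c = 0 /\ right_field a b c p = c *: orth_field p.
Proof.
have rm := riemannian_left_metric; have gU := riemannian_unitmx _ _ p rm.
have E0 := expR_neq0 (cz p).
have := nabla_right_field a b c p => /=.
set n2 := _ - t * _ * _; set n3 := _ - s * _ * _ => NE.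
have g2_gt0 : 0 < g2.
  have : 0 < g1 * g2 by have := sqr_ge0 k; move: det_gt0; lra.
  by rewrite pmulr_rgt0.
split.
- move=> N0; rewrite N0 mul0mx in NE.
  have h1 := congr1 (fun A : 'M[R]_3 => A 0 1) NE.
  have h2 := congr1 (fun A : 'M[R]_3 => A 0 2) NE.
  have h3 := congr1 (fun A : 'M[R]_3 => A 2 1) NE.
  move: h1 h2 h3; rewrite !mxE /table /= => /esym kc /esym + /esym.
  rewrite /n2 /n3 kc !mulr0 !subr0 => /eqP + /eqP.
  rewrite !mulf_eq0 (gt_eqF g1_gt0) (gt_eqF g2_gt0) !(negbTE (expR_neq0 _)) /= !subr_eq0.
  move=> /eqP h2 /eqP h3; split=> //.
  apply/rowP; elim/ord3P; rewrite [RHS]mxE !vec3E /=.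
  + transitivity (expR (cz p) * (s * c)); last by ring.
    by rewrite -h2 expRN /cx; field.
  + transitivity (expR (- cz p) * (t * c)); last by ring.
    by rewrite -h3 expRN /cy; field.
  + by rewrite mulr1.
- move=> [kc ZE].
  have h2 := congr1 (fun v : 'rV[R]_3 => v 0 0) ZE.
  have h3 := congr1 (fun v : 'rV[R]_3 => v 0 1) ZE.
  move: h2 h3; rewrite ![(c *: orth_field p) 0 _]mxE !vec3E /= => h2 h3.
  have n20 : n2 = 0 by rewrite /n2 /cx h2 kc expRN; field.
  have n30 : n3 = 0 by rewrite /n3 /cy -mulNr h3 kc expRN; field.
  rewrite kc n20 n30 in NE.
  rewrite -[LHS](mulmxK gU) NE; rewrite (_ : \matrix_(i, j) _ = 0) ?mul0mx //.
  by apply/matrixP; do 2 elim/ord3P; rewrite !mxE /table /= ?oppr0.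
Qed.

Lemma lie_derivative_left_metric X p :
  let L := lie_derivative_metric X left_metric p in
  let d i j := partial i (fun q => X q 0 j) p in
  let E := expR (cz p) in let F := expR (- cz p) in
  let g13 := - (s * g1 + t * k) * F in let g23 := - (s * k + t * g2) * E in
  let g33 := nu + s ^+ 2 * g1 + 2 * s * t * k + t ^+ 2 * g2 in
  [/\ L 0 0 = 2 * (d 0 0 * (g1 * (F * F)) + d 0 1 * k + d 0 2 * g13 - X p 0 2 * (g1 * (F * F))),
      L 1 1 = 2 * (d 1 0 * k + d 1 1 * (g2 * (E * E)) + d 1 2 * g23 + X p 0 2 * (g2 * (E * E)))
    & L 2 2 = 2 * (d 2 0 * g13 + d 2 1 * g23 + d 2 2 * g33)] /\
  [/\ L 0 1 = d 0 0 * k + d 0 1 * (g2 * (E * E)) + d 0 2 * g23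
        + (d 1 0 * (g1 * (F * F)) + d 1 1 * k + d 1 2 * g13),
      L 0 2 = d 0 0 * g13 + d 0 1 * g23 + d 0 2 * g33
        + (d 2 0 * (g1 * (F * F)) + d 2 1 * k + d 2 2 * g13) - X p 0 2 * g13
    & L 1 2 = d 1 0 * g13 + d 1 1 * g23 + d 1 2 * g33
        + (d 2 0 * k + d 2 1 * (g2 * (E * E)) + d 2 2 * g23) + X p 0 2 * g23].
Proof.
move=> L d; pose d' i j := d i j.
have LE i j : L i j = \sum_l (X p 0 l * partial l (fun q => left_metric q i j) p
    + d' i l * left_metric p l j + d' j l * left_metric p i l) by rewrite mxE.
rewrite -!/(d' _ _); clearbody d' L; clear d.
split; split; rewrite LE !sum3 !partial_left_metric !mxE /=; ring.
Qed.

(** In coordinates where V is [d/dz], the Killing equations take the form treated by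
    [killing_rigidity]; the solution is then carried back to the original coordinates. *)
Lemma killing_left_metric Z : killing left_metric Z ->
  exists a b c, Z = right_field a b c.
Proof.
move=> [smZ LZ].
(* The curves [z |-> w x y z] are the integral curves of V, and [d/dx], [d/dy] are unchanged. *)
pose w (x y z : R) : 'rV[R]_3 := vec3 (x + s * expR z) (y - t * expR (- z)) z.
pose D i j (x y z : R) := partial i (fun q => Z q 0 j) (w x y z).
have dZ j q : differentiable (fun q => Z q 0 j) q by exact: (smZ j [::] q).
have dZ2 i q : differentiable (partial i (fun q => Z q 0 2)) q by exact: (smZ 2 [:: i] q).
have dwx (f : 'rV[R]_3 -> R) x y z : differentiable f (w x y z) ->
    is_derive x 1 (fun u => f (w u y z)) (partial 0 f (w x y z)).
  move=> df; have du : is_derive x 1 (fun u => u + s * expR z) 1.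
    by apply: is_derive_eq; rewrite addr0.
  have := is_derive_curve f _ _ _ x _ _ _ df du
    (is_derive_cst _ x 1 : is_derive x 1 (fun=> y - t * expR (- z)) 0)
    (is_derive_cst _ x 1 : is_derive x 1 (fun=> z) 0).
  by rewrite mul1r !mul0r !addr0.
have dwy (f : 'rV[R]_3 -> R) x y z : differentiable f (w x y z) ->
    is_derive y 1 (fun u => f (w x u z)) (partial 1 f (w x y z)).
  move=> df; have du : is_derive y 1 (fun u => u - t * expR (- z)) 1.
    by apply: is_derive_eq; rewrite subr0.
  have := is_derive_curve f _ _ _ y _ _ _ df
    (is_derive_cst _ y 1 : is_derive y 1 (fun=> x + s * expR z) 0) du
    (is_derive_cst _ y 1 : is_derive y 1 (fun=> z) 0).
  by rewrite mul1r !mul0r addr0 add0r.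
have dexpN (z : R) : is_derive z 1 (fun u : R => expR (- u)) (expR (- z) * - 1).
  exact: is_derive1_comp.
have dwz (f : 'rV[R]_3 -> R) x y z : differentiable f (w x y z) ->
    is_derive z 1 (fun u => f (w x y u)) (s * expR z * partial 0 f (w x y z)
      + t * expR (- z) * partial 1 f (w x y z) + partial 2 f (w x y z)).
  move=> df; have du : is_derive z 1 (fun u => x + s * expR u) (s * expR z).
    by apply: is_derive_eq; rewrite /GRing.scale /=; ring.
  have dv : is_derive z 1 (fun u => y - t * expR (- u)) (t * expR (- z)).
    have := dexpN z => d; apply: is_derive_eq.
    by rewrite /GRing.scale /=; ring.
  have := is_derive_curve f _ _ _ z _ _ _ df du dv (is_derive_id z 1).
  by rewrite mul1r.
have L0 i j x y z : lie_derivative_metric Z left_metric (w x y z) i j = 0.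
  by rewrite LZ mxE.
pose V j x y z := s * expR z * D 0 j x y z + t * expR (- z) * D 1 j x y z + D 2 j x y z.
have E0 z := expR_neq0 z.
have LE x y z := lie_derivative_left_metric Z (w x y z).
have czw x y z : cz (w x y z) = z by rewrite /cz vec3E.
(* The next identities contract the Lie derivative of the metric with the
   frame d/dx, d/dy, V where V = d/dz + s e^z d/dx + t e^-z d/dy. *)
have V2 x y z : V 2 x y z = 0.
  apply: (mulfI (lt0r_neq0 nu_gt0)); rewrite mulr0.
  transitivity (2^-1 * ((s * expR z) ^+ 2 * lie_derivative_metric Z left_metric (w x y z) 0 0
    + (t * expR (- z)) ^+ 2 * lie_derivative_metric Z left_metric (w x y z) 1 1
    + lie_derivative_metric Z left_metric (w x y z) 2 2
    + 2 * s * t * lie_derivative_metric Z left_metric (w x y z) 0 1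
    + 2 * (s * expR z) * lie_derivative_metric Z left_metric (w x y z) 0 2
    + 2 * (t * expR (- z)) * lie_derivative_metric Z left_metric (w x y z) 1 2));
    last by rewrite !L0; ring.
  have := LE x y z; rewrite /= czw -!/(D _ _ x y z) => -[[-> -> ->] [-> -> ->]]; rewrite /V expRN.
  move: (D 0 0 x y z) (D 0 1 x y z) (D 0 2 x y z) (D 1 0 x y z) (D 1 1 x y z) (D 1 2 x y z)
    (D 2 0 x y z) (D 2 1 x y z) (D 2 2 x y z) (Z _ 0 2) (E0 z) => *.
  by field.
(* The V-component of [Z] is constant along V, so it and its x- and y-derivatives are functions of
   [x], [y] alone. *)
have Zw x y z : Z (w x y z) 0 2 = Z (w x y 0) 0 2.
  apply: (@is_derive_0_is_cst _ (fun z => Z (w x y z) 0 2)) => u.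
  by have := dwz _ x y u (dZ 2 _); rewrite -/(V 2 x y u) V2.
have D0 x y z : D 0 2 x y z = D 0 2 x y 0.
  apply: (is_derive_unique _ _ _ _ (dwx _ x y z (dZ 2 _))).
  by rewrite (_ : (fun u => _) = (fun u => Z (w u y 0) 0 2)); [exact: dwx|apply/funext => u].
have D1 x y z : D 1 2 x y z = D 1 2 x y 0.
  apply: (is_derive_unique _ _ _ _ (dwy _ x y z (dZ 2 _))).
  by rewrite (_ : (fun u => _) = (fun u => Z (w x u 0) 0 2)); [exact: dwy|apply/funext => u].
have V2' x y z : D 2 2 x y z = - (s * expR z * D 0 2 x y z + t * expR (- z) * D 1 2 x y z).
  by apply/eqP; rewrite -addr_eq0 addrC; apply/eqP; exact: V2.
(* [Z = a d/dx + b d/dy + c V]; [az] and [bz] are the z-derivatives of [a] and [b], simplified by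
   [V2]. *)
pose a x y z := Z (w x y z) 0 0 - s * expR z * Z (w x y z) 0 2.
pose b x y z := Z (w x y z) 0 1 - t * expR (- z) * Z (w x y z) 0 2.
pose c x y := Z (w x y 0) 0 2.
pose az x y z := V 0 x y z - s * expR z * Z (w x y z) 0 2.
pose bz x y z := V 1 x y z + t * expR (- z) * Z (w x y z) 0 2.
have rigid := killing_rigidity g1 k g2 nu a b
  (fun x y z => D 0 0 x y z - s * expR z * D 0 2 x y z)
  (fun x y z => D 1 0 x y z - s * expR z * D 1 2 x y z) az
  (fun x y z => D 0 1 x y z - t * expR (- z) * D 0 2 x y z)
  (fun x y z => D 1 1 x y z - t * expR (- z) * D 1 2 x y z) bz
  c (fun x y => D 0 2 x y 0) (fun x y => D 1 2 x y 0)
  (fun x y => partial 0 (partial 0 (fun q => Z q 0 2)) (w x y 0))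
  (fun x y => partial 1 (partial 0 (fun q => Z q 0 2)) (w x y 0))
  (fun x y => partial 0 (partial 1 (fun q => Z q 0 2)) (w x y 0))
  (fun x y => partial 1 (partial 1 (fun q => Z q 0 2)) (w x y 0))
  g1_gt0 det_gt0 nu_gt0.
have {}rigid : forall x y z, [/\ c x y = c 0 0, a x y z = a 0 0 0 + c 0 0 * x
    & b x y z = b 0 0 0 - c 0 0 * y].
  apply: rigid => [x y z|x y z|x y z|x y z|x y z|x y z|x y|x y|x y|x y|x y|x y
    |x y z|x y z|x y z|x y z|x y z].
  - have h0 := dwx _ x y z (dZ 0 _); have h2 := dwx _ x y z (dZ 2 _).
    by apply: is_derive_eq; rewrite /GRing.scale /= /D; ring.
  - have h0 := dwy _ x y z (dZ 0 _); have h2 := dwy _ x y z (dZ 2 _).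
    by apply: is_derive_eq; rewrite /GRing.scale /= /D; ring.
  - have h0 := dwz _ x y z (dZ 0 _); have h2 := dwz _ x y z (dZ 2 _).
    rewrite -/(D 0 0 x y z) -/(D 1 0 x y z) -/(D 2 0 x y z) -/(V 0 x y z) in h0.
    rewrite -/(D 0 2 x y z) -/(D 1 2 x y z) -/(D 2 2 x y z) -/(V 2 x y z) V2 in h2.
    by apply: is_derive_eq; rewrite /GRing.scale /= /az; ring.
  - have h0 := dwx _ x y z (dZ 1 _); have h2 := dwx _ x y z (dZ 2 _).
    by apply: is_derive_eq; rewrite /GRing.scale /= /D; ring.
  - have h0 := dwy _ x y z (dZ 1 _); have h2 := dwy _ x y z (dZ 2 _).
    by apply: is_derive_eq; rewrite /GRing.scale /= /D; ring.
  - have h0 := dwz _ x y z (dZ 1 _); have h2 := dwz _ x y z (dZ 2 _).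
    rewrite -/(D 0 1 x y z) -/(D 1 1 x y z) -/(D 2 1 x y z) -/(V 1 x y z) in h0.
    rewrite -/(D 0 2 x y z) -/(D 1 2 x y z) -/(D 2 2 x y z) -/(V 2 x y z) V2 in h2.
    have dN := dexpN z.
    by apply: is_derive_eq; rewrite /GRing.scale /= /bz; ring.
  - exact: dwx.
  - exact: dwy.
  - exact: dwx.
  - exact: dwy.
  - exact: dwx.
  - exact: dwy.
  - transitivity (s * expR z * lie_derivative_metric Z left_metric (w x y z) 0 0
      + t * expR (- z) * lie_derivative_metric Z left_metric (w x y z) 0 1
      + lie_derivative_metric Z left_metric (w x y z) 0 2); last by rewrite !L0; ring.
    have := LE x y z; rewrite /= czw -!/(D _ _ x y z) => -[[-> _ _] [-> -> _]].
    rewrite -(D0 x y z) /az /bz /V V2' expRN.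
    move: (D 0 0 x y z) (D 0 1 x y z) (D 0 2 x y z) (D 1 0 x y z) (D 1 1 x y z) (D 1 2 x y z)
      (D 2 0 x y z) (D 2 1 x y z) (Z _ 0 2) (E0 z) => *.
    by field.
  - transitivity (s * expR z * lie_derivative_metric Z left_metric (w x y z) 0 1
      + t * expR (- z) * lie_derivative_metric Z left_metric (w x y z) 1 1
      + lie_derivative_metric Z left_metric (w x y z) 1 2); last by rewrite !L0; ring.
    have := LE x y z; rewrite /= czw -!/(D _ _ x y z) => -[[_ -> _] [-> _ ->]].
    rewrite -(D1 x y z) /az /bz /V V2' expRN.
    move: (D 0 0 x y z) (D 0 1 x y z) (D 0 2 x y z) (D 1 0 x y z) (D 1 1 x y z) (D 1 2 x y z)
      (D 2 0 x y z) (D 2 1 x y z) (Z _ 0 2) (E0 z) => *.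
    by field.
  - transitivity (2^-1 * lie_derivative_metric Z left_metric (w x y z) 0 0);
      last by rewrite L0 mulr0.
    have := LE x y z; rewrite /= czw -!/(D _ _ x y z) => -[[-> _ _] _].
    rewrite /c -(Zw x y z) expRN.
    move: (D _ 0 x y z) (D _ 1 x y z) (D _ 2 x y z) (Z _ 0 2) (E0 z) => *.
    by field.
  - transitivity (2^-1 * lie_derivative_metric Z left_metric (w x y z) 1 1);
      last by rewrite L0 mulr0.
    have := LE x y z; rewrite /= czw -!/(D _ _ x y z) => -[[_ -> _] _].
    rewrite /c -(Zw x y z) expRN.
    move: (D _ 0 x y z) (D _ 1 x y z) (D _ 2 x y z) (Z _ 0 2) (E0 z) => *.
    by field.
  - have := LE x y z; rewrite /= czw -!/(D _ _ x y z) => -[_ [LE01 _ _]].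
    transitivity (lie_derivative_metric Z left_metric (w x y z) 0 1); last exact: L0.
    rewrite LE01 expRN; move: (D 0 0 x y z) (D 0 1 x y z) (D 0 2 x y z)
      (D 1 0 x y z) (D 1 1 x y z) (D 1 2 x y z) (E0 z) => *.
    by field.
exists (a 0 0 0), (b 0 0 0), (c 0 0); apply/funext => p.
(* The inverse of the change of coordinates [w]. *)
pose x := p 0 0 - s * expR (p 0 2); pose y := p 0 1 + t * expR (- p 0 2).
have pE : p = w x y (p 0 2) by rewrite [LHS]vec3_eta /w /x /y subrK addrK.
have [cE aE bE] := rigid x y (p 0 2).
have Z2 : Z p 0 2 = c 0 0 by rewrite {1}pE Zw -/(c x y) cE.
apply/rowP; elim/ord3P; rewrite vec3E /=.
- transitivity (a x y (p 0 2) + s * expR (p 0 2) * Z p 0 2); first by rewrite /a -pE; ring.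
  by rewrite aE Z2 /x; ring.
- transitivity (b x y (p 0 2) + t * expR (- p 0 2) * Z p 0 2); first by rewrite /b -pE; ring.
  by rewrite bE Z2 /y; ring.
- exact: Z2.
Qed.

End Metric.
End LeftInvariant.

(** * Index of symmetry *)

Section Dimension.
Context {R : realType} (n : nat).

Lemma dimension_eq0 : dimension [set (0 : 'rV[R]_n)] = 0%N.
Proof.
apply/eqP; rewrite -leqn0; apply/bigmax_leqP => d /asboolP [B [Bfree Brow]].
rewrite -(eqP Bfree) (_ : B = 0) ?mxrank0 //.
by apply/row_matrixP => i; rewrite row0; exact: Brow.
Qed.

Lemma dimension_line (w : 'rV[R]_n) : w != 0 ->
  dimension [set v | exists c : R, v = c *: w] = 1%N.
Proof.
move=> w0; have rw : \rank w = 1%N by rewrite rank_rV w0.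
apply/eqP; rewrite eqn_leq; apply/andP; split.
  apply/bigmax_leqP => d /asboolP [B [Bfree Brow]].
  rewrite -(eqP Bfree) -rw; apply: mxrankS; apply/row_subP => i.
  by have [c ->] := Brow i; exact: scalemx_sub.
(* The maximum ranges over [d < n.+1], so 1 is admissible only if [n] is positive; the nonzero [w]
   guarantees this. *)
have n1 : (1 < n.+1)%N by rewrite -rw ltnS rank_leq_col.
apply: leq_trans (leq_bigmax_cond (Ordinal n1) _) => //.
apply/asboolP; exists w; split; first by rewrite /row_free rw.
by move=> r; exists 1; rewrite scale1r; apply/rowP => j; rewrite mxE (ord1 r).
Qed.

End Dimension.

(** * Symmetric subspaces and the reduction to [left_metric] *)

Section E11.
Context {R : realType}.
Implicit Types (p : 'rV[R]_3) (g : 'rV[R]_3 -> 'M[R]_3).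

Lemma symmetric_space_left_metric (g1 k g2 s t nu : R) p :
  0 < g1 -> 0 < g1 * g2 - k ^+ 2 -> 0 < nu ->
  symmetric_space (left_metric g1 k g2 s t nu) p
  = [set v | exists c : R, k * c = 0 /\ v = c *: orth_field s t p].
Proof.
move=> g1_gt0 det_gt0 nu_gt0; apply/seteqP; split=> v /=.
- move=> [X [KX <-]];
  have [a [b [c ->]]] := killing_left_metric _ _ _ _ _ _ g1_gt0 det_gt0 nu_gt0 _ KX.
  by move=> /nabla_right_field_eq0 [] // kc ->; exists c.
- move=> [c [kc ->]].
  (* [a] and [b] are solved from [right_field a b c p = c V p]. *)
  pose a := s * expR (cz p) * c - c * cx p.
  pose b := t * expR (- cz p) * c + c * cy p.
  have ZE : right_field a b c p = c *: orth_field s t p.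
    by apply/rowP; elim/ord3P; rewrite [RHS]mxE !vec3E /= /a /b /cx /cy; ring.
  exists (right_field a b c); split=> //; first exact: killing_right_field.
  by apply/nabla_right_field_eq0.
Qed.

Lemma orth_field_neq0 (s t : R) p : orth_field s t p != 0.
Proof.
apply/eqP => /(congr1 (fun v : 'rV[R]_3 => v 0 2)).
by rewrite vec3E mxE => /eqP; rewrite oner_eq0.
Qed.

(** The boolean is read as 1 or 0: for [k = 0] the symmetric subspace is the line through V,
    otherwise [k c = 0] forces [c = 0]. *)
Lemma index_left_metric (g1 k g2 s t nu : R) p :
  0 < g1 -> 0 < g1 * g2 - k ^+ 2 -> 0 < nu ->
  index_of_symmetry (left_metric g1 k g2 s t nu) p = (k == 0).
Proof.
move=> g1_gt0 det_gt0 nu_gt0; rewrite /index_of_symmetry symmetric_space_left_metric //.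
have [->|k0] := eqVneq k 0.
  rewrite (_ : [set v | _] = [set v | exists c : R, v = c *: orth_field s t p]).
    by rewrite dimension_line ?orth_field_neq0.
  by apply/seteqP; split=> v [c]; [case=> _ ->|move=> ->]; exists c; rewrite ?mul0r.
rewrite (_ : [set v | _] = [set 0]) ?dimension_eq0 //.
apply/seteqP; split=> v /=.
  by move=> [c [/eqP + ->]]; rewrite mulf_eq0 (negbTE k0) /= => /eqP ->; rewrite scale0r.
by move=> ->; exists 0; rewrite mulr0 scale0r.
Qed.

Lemma jacobian_e11_mul a p :
  jacobian (e11_mul a) p = diag_mx (vec3 (expR (cz a)) (expR (- cz a)) 1).
Proof.
apply/matrixP => i j.
rewrite (_ : e11_mul a = fun q =>
    vec3 (sem (Add (Cst (cx a)) (Mul (Cst (expR (cz a))) (Coord 0))) q)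
      (sem (Add (Cst (cy a)) (Mul (Cst (expR (- cz a))) (Coord 1))) q)
      (sem (Add (Cst (cz a)) (Coord 2)) q)) // jacobian_eval mxE.
by move: i j; do 2 elim/ord3P; rewrite ?mxE /=; ring.
Qed.

Lemma e11_mule1 a : e11_mul a (e11_id R) = a.
Proof.
by apply/rowP; elim/ord3P; rewrite vec3E /cx /cy /cz /e11_id ?vec3E ?mulr0 addr0.
Qed.

(** Left translation by [p] carries the Gram matrix at the identity to the one at [p], so six
    numbers read off at the identity determine [g]. *)
Lemma left_invariant_left_metric g : riemannian_metric g -> left_invariant_metric g ->
  exists g1 k g2 s t nu : R, [/\ 0 < g1, 0 < g1 * g2 - k ^+ 2, 0 < nu
    & g = left_metric g1 k g2 s t nu].
Proof.
move=> gR gL; have [_ _ gP] := gR.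
set e := e11_id R.
pose g1 := g e 0 0; pose k := g e 0 1; pose g2 := g e 1 1.
(* [s] and [t] solve by Cramer's rule the orthogonality of [(s, t, 1)] to the first two coordinate
   vectors at [e]. *)
pose s := (k * g e 1 2 - g2 * g e 0 2) / (g1 * g2 - k ^+ 2).
pose t := (k * g e 0 2 - g1 * g e 1 2) / (g1 * g2 - k ^+ 2).
pose nu := g e 2 2 - (s ^+ 2 * g1 + 2 * s * t * k + t ^+ 2 * g2).
have gS i j : g e j i = g e i j.
  by have := riemannian_sym _ g e gR => /matrixP /(_ i j); rewrite mxE.
have v0 (a b c : R) (i : 'I_3) : vec3 a b c 0 i != 0 -> vec3 a b c != 0.
  by apply: contra_neq => ->; rewrite mxE.
have g1_gt0 : 0 < g1.
  have := gP e (vec3 1 0 0) (v0 _ _ _ 0 _).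
  by rewrite inner3 !vec3E !(mul0r, mulr0, mul1r, mulr1, addr0) => -> //; exact: oner_neq0.
have det_gt0 : 0 < g1 * g2 - k ^+ 2.
  (* This vector is orthogonal to the first coordinate vector and has squared length
     [g1 (g1 g2 - k^2)]. *)
  have := gP e (vec3 (- k) g1 0) (v0 _ _ _ 1 _).
  rewrite inner3 !vec3E (gS 0 1) (gS 0 2) (gS 1 2) -/g1 -/k -/g2 (gt_eqF g1_gt0) => /(_ isT).
  by rewrite (_ : _ + _ = g1 * (g1 * g2 - k ^+ 2)) ?pmulr_rgt0 //; ring.
have det0 : g1 * g2 - k ^+ 2 != 0 by rewrite gt_eqF.
have g02 : g e 0 2 = - (s * g1 + t * k) by rewrite /s /t; field.
have g12 : g e 1 2 = - (s * k + t * g2) by rewrite /s /t; field.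
have nu_gt0 : 0 < nu.
  have := gP e (vec3 s t 1) (v0 _ _ _ 2 _).
  rewrite inner3 !vec3E (gS 0 1) (gS 0 2) (gS 1 2) -/g1 -/k -/g2 g02 g12 oner_neq0 => /(_ isT).
  by rewrite (_ : _ + _ = nu) // /nu; ring.
exists g1, k, g2, s, t, nu; split=> //.
apply/funext => p; apply/matrixP => i j; rewrite [RHS]mxE.
have id (c d : R) : inner g p (c *: delta_mx 0 i) (d *: delta_mx 0 j) = c * d * g p i j.
  by rewrite /inner linearZ /= -scalemxAr -!scalemxAl -rowE trmx_delta -colE !mxE; ring.
have ie : inner g e (delta_mx 0 i) (delta_mx 0 j) = g e i j.
  by rewrite /inner -rowE trmx_delta -colE !mxE.
have := gL p e (delta_mx 0 i) (delta_mx 0 j).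
rewrite e11_mule1 jacobian_e11_mul -!rowE !row_diag_mx id ie.
have E0 := expR_neq0 (cz p).
move: i j {id ie}; do 2 elim/ord3P; rewrite !vec3E /= ?expRN => H.
- by rewrite /g1 -H; field.
- by rewrite /k -H; field.
- by rewrite -g02 -H; field.
- by rewrite /k -(gS 0 1) -H; field.
- by rewrite /g2 -H; field.
- by rewrite -g12 -H; field.
- by rewrite -g02 -(gS 0 2) -H; field.
- by rewrite -g12 -(gS 1 2) -H; field.
- transitivity (g e 2 2); first by rewrite -H; ring.
  by rewrite /nu; ring.
Qed.

End E11.

(** * Isometric automorphisms *)

Section Automorphisms.
Context {R : realType}.
Implicit Types (p q : 'rV[R]_3).

Lemma g_nuE (nu : R) : g_nu nu = left_metric 1 0 1 0 0 nu.
Proof.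
apply/funext => p; have E0 := expR_neq0 (cz p).
(* The inverse of the diagonal matrix [frame p]. *)
pose D := diag_mx (vec3 (expR (- cz p)) (expR (cz p)) 1).
have DF : D *m frame p = 1%:M.
  apply/matrixP => i j; rewrite mul_diag_mx !mxE.
  by move: i j; do 2 elim/ord3P; rewrite !vec3E ?mxE /= ?expRN ?mulr0 // ?mulr1 ?mulVf ?mulfV.
have [_ Fu] := mulmx1_unit DF.
have -> : g_nu nu p = D *m diag_mx (vec3 1 1 nu) *m D.
  have -> : g_nu nu p = invmx (frame p) *m diag_mx (vec3 1 1 nu) *m (invmx (frame p))^T by [].
  have -> : invmx (frame p) = D by rewrite -[LHS]mul1mx -DF mulmxK.
  by rewrite tr_diag_mx.
rewrite /D !mulmx_diag; apply/matrixP => i j; rewrite !mxE.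
by move: i j; do 2 elim/ord3P; rewrite /= ?mxE /=; ring.
Qed.

(* The automorphism sends [s X1 + t X2 + X3] at the identity to [X3]. *)
Definition straighten (a b s t : R) p : 'rV[R]_3 :=
  vec3 (sem (Mul (Cst a) (Add (Coord 0) (Mul (Cst (- s)) (Add Exp (Cst (- 1)))))) p)
    (sem (Mul (Cst b) (Add (Coord 1) (Mul (Cst t) (Add ExpN (Cst (- 1)))))) p)
    (sem (Coord 2) p).

(** The map is conjugation by [(s, -t, 0)] followed by the rescaling of x by [a] and y by [b]. *)
Lemma straighten_automorphism (a b s t : R) : a != 0 -> b != 0 ->
  lie_automorphism (straighten a b s t).
Proof.
move=> a0 b0; split.
  move=> p q; apply/rowP; elim/ord3P; rewrite /straighten !vec3E /= /e11_mul.
  - by rewrite /cx /cz !vec3E expRD; ring.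
  - by rewrite /cy /cz !vec3E opprD expRD; ring.
  - by rewrite /cz !vec3E.
exists (fun p => vec3 (sem (Add (Mul (Cst a^-1) (Coord 0)) (Mul (Cst s) (Add Exp (Cst (- 1))))) p)
  (sem (Add (Mul (Cst b^-1) (Coord 1)) (Mul (Cst (- t)) (Add ExpN (Cst (- 1))))) p)
  (sem (Coord 2) p)).
split; [| |exact: smooth_vec3_eval|exact: smooth_vec3_eval].
- by move=> p; apply/rowP; elim/ord3P; rewrite !vec3E /= /cz !vec3E //=; field.
- by move=> p; apply/rowP; elim/ord3P; rewrite !vec3E /= /cz !vec3E //=; field.
Qed.

(** The differential sends [X1], [X2], V to [a X1], [b X2], [X3], whose Gram matrix for [g_nu nu] is
    [diag(a^2, b^2, nu)]. *)
Lemma straighten_isometric (a b s t nu : R) :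
  isometric_map (straighten a b s t) (left_metric (a ^+ 2) 0 (b ^+ 2) s t nu) (g_nu nu).
Proof.
move=> p u v; have E0 := expR_neq0 (cz p).
rewrite g_nuE !inner_left_metric.
have zE : cz (straighten a b s t p) = cz p by rewrite /cz vec3E.
have J (w : 'rV[R]_3) j : (w *m jacobian (straighten a b s t) p) 0 j
    = vec3 (a * (w 0 0 - s * expR (cz p) * w 0 2))
        (b * (w 0 1 - t * expR (- cz p) * w 0 2)) (w 0 2) 0 j.
  by rewrite mxE sum3 !jacobian_eval; move: j; elim/ord3P; rewrite !vec3E /=; ring.
by rewrite zE !J !vec3E expRN; field.
Qed.

(** * Images of the axes of the ideal under an endomorphism *)

Section Orthogonality.
Context (phi : 'rV[R]_3 -> 'rV[R]_3).
Hypothesis phiM : forall p q, phi (e11_mul p q) = e11_mul (phi p) (phi q).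

Let T := phi (vec3 0 0 (ln 2)).
Let P x := phi (vec3 x 0 0).
Let Q y := phi (vec3 0 y 0).

(* Conjugation by (0, 0, ln 2) doubles (x, 0, 0) and halves (0, y, 0); the image
   of (0, 0, ln 2) acts on the images of both with the same two eigenvalues. *)
Lemma morphism_axes x y : [/\ P x 0 2 = 0, Q y 0 2 = 0, P x 0 0 * Q y 0 0 = 0
  & P x 0 1 * Q y 0 1 = 0].
Proof.
have e2 : expR (ln 2) = 2 :> R by rewrite lnK // posrE.
have PP : P (2 * x) = e11_mul (P x) (P x).
  rewrite -phiM; congr phi; apply/rowP; elim/ord3P;
    by rewrite /e11_mul /cx /cy /cz !vec3E ?oppr0 ?expR0; ring.
have QQ : Q (2 * y) = e11_mul (Q y) (Q y).
  rewrite -phiM; congr phi; apply/rowP; elim/ord3P;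
    by rewrite /e11_mul /cx /cy /cz !vec3E ?oppr0 ?expR0; ring.
have TP : e11_mul T (P x) = e11_mul (P (2 * x)) T.
  rewrite -!phiM; congr phi; apply/rowP; elim/ord3P;
    by rewrite /e11_mul /cx /cy /cz !vec3E ?oppr0 ?expR0 ?e2; ring.
have TQ : e11_mul (Q y) T = e11_mul T (Q (2 * y)).
  rewrite -!phiM; congr phi; apply/rowP; elim/ord3P;
    by rewrite /e11_mul /cx /cy /cz !vec3E ?oppr0 ?expR0 ?expRN ?e2; field.
have coord (A B : 'rV[R]_3) j : A = B -> A 0 j = B 0 j by move->.
have P2 := coord _ _ 2 PP; have Q2 := coord _ _ 2 QQ.
have TP2 := coord _ _ 2 TP; have TQ2 := coord _ _ 2 TQ.
rewrite /e11_mul /cz !vec3E in P2 Q2 TP2 TQ2.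
(* The z-coordinate is additive: doubling multiplies it by 2, while conjugation by [T] preserves
   it. *)
have P20 : P x 0 2 = 0 by lra.
have Q20 : Q y 0 2 = 0 by lra.
have P0 := coord _ _ 0 PP; have Q0 := coord _ _ 0 QQ.
have TP0 := coord _ _ 0 TP; have TQ0 := coord _ _ 0 TQ.
have P1 := coord _ _ 1 PP; have Q1 := coord _ _ 1 QQ.
have TP1 := coord _ _ 1 TP; have TQ1 := coord _ _ 1 TQ.
rewrite /e11_mul /cx /cy /cz !vec3E ?P2 ?Q2 ?P20 ?Q20 ?addr0 ?oppr0 ?expR0 ?mul1r
  in P0 Q0 TP0 TQ0 P1 Q1 TP1 TQ1.
rewrite P0 in TP0; rewrite Q0 in TQ0; rewrite P1 in TP1; rewrite Q1 in TQ1.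
split=> //.
- have h1 : expR (T 0 2) * P x 0 0 = 2 * P x 0 0 by lra.
  have h2 : 2 * (expR (T 0 2) * Q y 0 0) = Q y 0 0 by lra.
  (* By [h1] the left side is also four times the product, which therefore vanishes. *)
  have h3 : 2 * (expR (T 0 2) * P x 0 0) * Q y 0 0 = P x 0 0 * Q y 0 0.
    by rewrite -[in RHS]h2; ring.
  by move: h3; rewrite h1; lra.
- have h1 : expR (- T 0 2) * P x 0 1 = 2 * P x 0 1 by lra.
  have h2 : 2 * (expR (- T 0 2) * Q y 0 1) = Q y 0 1 by lra.
  have h3 : 2 * (expR (- T 0 2) * P x 0 1) * Q y 0 1 = P x 0 1 * Q y 0 1.
    by rewrite -[in RHS]h2; ring.
  by move: h3; rewrite h1; lra.
Qed.

Lemma morphism_jacobian : smooth_map phi ->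
  let J := jacobian phi (e11_id R) in
  [/\ J 0 2 = 0, J 1 2 = 0, J 0 0 * J 1 0 = 0 & J 0 1 * J 1 1 = 0].
Proof.
move=> phi_smooth J.
have dphi j : differentiable (fun q => phi q 0 j) (e11_id R) by exact: (phi_smooth j [::]).
have JP j : is_derive (0 : R) 1 (fun x => P x 0 j) (J 0 j).
  by rewrite /J jacobianE //; exact: (partial_is_derive_x (fun q => phi q 0 j)).
have JQ j : is_derive (0 : R) 1 (fun y => Q y 0 j) (J 1 j).
  by rewrite /J jacobianE //; exact: (partial_is_derive_y (fun q => phi q 0 j)).
have der0 (f : R -> R) (d : R) : is_derive (0 : R) 1 f d -> (forall x, f x = 0) -> d = 0.
  move=> df f0; apply: (is_derive_unique _ _ _ _ df).
  by rewrite (_ : f = cst 0); [exact: is_derive_cst|apply/funext].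
have prod0 j : (forall x y, P x 0 j * Q y 0 j = 0) -> J 0 j * J 1 j = 0.
  (* Either the j-th coordinate vanishes along the whole first axis, or one nonzero value there
     makes it vanish along the whole second axis; one of the two derivatives is then zero. *)
  move=> PQ; have [P0|] := pselect (forall x, P x 0 j = 0).
    by rewrite (der0 _ _ (JP j) P0) mul0r.
  move=> /existsNP [x /eqP Px]; rewrite (der0 _ _ (JQ j)) ?mulr0 // => y.
  by have /eqP := PQ x y; rewrite mulf_eq0 (negbTE Px) => /eqP.
split.
- by apply: (der0 _ _ (JP 2)) => x; have [] := morphism_axes x 0.
- by apply: (der0 _ _ (JQ 2)) => y; have [] := morphism_axes 0 y.
- by apply: prod0 => x y; have [] := morphism_axes x y.
- by apply: prod0 => x y; have [] := morphism_axes x y.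
Qed.

End Orthogonality.

Lemma isometric_g_nu_orthogonal (g1 k g2 s t nu nu' : R) phi :
  lie_automorphism phi -> isometric_map phi (left_metric g1 k g2 s t nu) (g_nu nu') ->
  k = 0.
Proof.
move=> [phiM [psi [_ _ phi_smooth _]]] /(_ (e11_id R) (vec3 1 0 0) (vec3 0 1 0)).
have [J02 J12 J00 J01] := morphism_jacobian phi phiM phi_smooth.
have M (w : 'rV[R]_3) (A : 'M[R]_3) j :
    (w *m A) 0 j = w 0 0 * A 0 j + w 0 1 * A 1 j + w 0 2 * A 2 j.
  by rewrite mxE sum3.
rewrite g_nuE !inner_left_metric !M !vec3E J02 J12 [cz (e11_id R)]vec3E oppr0 expR0.
set a := expR (- _); set b := expR _ => H.
(* The zeros stand for [J 0 0 * J 1 0] and [J 0 1 * J 1 1]; the isometry equates [k] with the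
   product of the images of the first two coordinate vectors. *)
have -> : k = a ^+ 2 * 0 + b ^+ 2 * 0; last by ring.
by rewrite -{1}J00 -J01; move: H; lra.
Qed.

End Automorphisms.

(** * The theorem *)

Section RightInvariance.
Context {R : realType}.
Implicit Types (p a : 'rV[R]_3).

Lemma mulmx_jacobian_right_translation a p v :
  v *m jacobian (fun q => e11_mul q a) p =
  vec3 (v 0 0 + v 0 2 * (expR (cz p) * cx a)) (v 0 1 - v 0 2 * (expR (- cz p) * cy a)) (v 0 2).
Proof.
rewrite (_ : (fun q => e11_mul q a) = fun q =>
  vec3 (sem (Add (Coord 0) (Mul Exp (Cst (cx a)))) q)
    (sem (Add (Coord 1) (Mul ExpN (Cst (cy a)))) q)
    (sem (Add (Coord 2) (Cst (cz a))) q)) //.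
apply/rowP => j; rewrite mxE sum3 !jacobian_eval.
by move: j; elim/ord3P; rewrite !vec3E /=; ring.
Qed.

Lemma right_invariant_right_field (a b c : R) : right_invariant_field (right_field a b c).
Proof.
move=> q p; rewrite mulmx_jacobian_right_translation.
by apply/rowP; elim/ord3P; rewrite /right_field !vec3E /= /e11_mul /cx /cy ?vec3E; ring.
Qed.

Lemma e11_mul1e p : e11_mul (e11_id R) p = p.
Proof.
apply/rowP; elim/ord3P; rewrite /e11_mul /cx /cy /cz /e11_id !vec3E ?oppr0 ?expR0; ring.
Qed.

Lemma scale_right_field (c : R) p : c *: right_field 0 0 1 p = right_field 0 0 c p.
Proof. by apply/rowP; elim/ord3P; rewrite mxE !vec3E /=; ring. Qed.

Lemma orth_field_e11_id (c : R) : c *: orth_field 0 0 (e11_id R) = vec3 0 0 c.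
Proof. by apply/rowP; elim/ord3P; rewrite mxE !vec3E; ring. Qed.

End RightInvariance.

Theorem theorem7p1 (R : realType) :
  (forall g : 'rV[R]_3 -> 'M[R]_3,
     riemannian_metric g -> left_invariant_metric g ->
     forall p : 'rV[R]_3,
       index_of_symmetry g p <> 0%N <->
       exists nu : R, 0 < nu /\
         exists phi : 'rV[R]_3 -> 'rV[R]_3,
           lie_automorphism phi /\ isometric_map phi g (g_nu nu))
  /\
  (forall nu : R, 0 < nu ->
     (forall p : 'rV[R]_3, index_of_symmetry (g_nu nu) p = 1%N)
     /\
     exists Y : 'rV[R]_3 -> 'rV[R]_3,
       [/\ right_invariant_field Y,
           killing (g_nu nu) Y,
           Y (e11_id R) <> 0,
           (forall Y' : 'rV[R]_3 -> 'rV[R]_3,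
              (right_invariant_field Y' /\
               forall a b : R,
                 inner (g_nu nu) (e11_id R) (Y' (e11_id R))
                   (a *: X1 (e11_id R) + b *: X2 (e11_id R)) = 0) <->
              exists c : R, forall p, Y' p = c *: Y p)
         & (forall Z : 'rV[R]_3 -> 'rV[R]_3,
              (killing (g_nu nu) Z /\ nabla (g_nu nu) Z (e11_id R) = 0) <->
              exists c : R, forall p, Z p = c *: Y p)]).
Proof.
split.
  move=> g gR gL p.
  have [g1 [k [g2 [s [t [nu [g1_gt0 det_gt0 nu_gt0 gE]]]]]]] :=
    left_invariant_left_metric g gR gL.
  subst g; rewrite index_left_metric //; split; last first.
    move=> [nu' [_ [phi [phi_aut phi_iso]]]].
    by rewrite (isometric_g_nu_orthogonal _ _ _ _ _ _ _ _ phi_aut phi_iso) eqxx.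
  have [k0 _|//] := eqVneq k 0; subst k.
  have g2_gt0 : 0 < g2 by move: det_gt0; rewrite expr0n subr0 pmulr_rgt0.
  (* The square roots are the lengths of [X1] and [X2], which the target metric normalises to 1. *)
  exists nu; split=> //; exists (straighten (Num.sqrt g1) (Num.sqrt g2) s t); split.
    by apply: straighten_automorphism; rewrite gt_eqF // sqrtr_gt0.
  have := straighten_isometric (Num.sqrt g1) (Num.sqrt g2) s t nu.
  by rewrite !sqr_sqrtr // ltW.
move=> nu nu_gt0.
have det1 : 0 < 1 * 1 - 0 ^+ 2 :> R by rewrite expr0n subr0 mulr1.
split=> [p|]; first by rewrite g_nuE index_left_metric // eqxx.
(* The field [(x, -y, 1)], equal to [X3] at the identity. *)
exists (right_field 0 0 1); split.
- exact: right_invariant_right_field.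
- by rewrite g_nuE; exact: killing_right_field.
- move=> /(congr1 (fun v : 'rV[R]_3 => v 0 2)); rewrite vec3E mxE /= => /eqP.
  by rewrite oner_eq0.
- move=> Y; rewrite g_nuE; split.
    move=> [Yinv Yorth]; exists (Y (e11_id R) 0 2) => p.
    have Y0 : Y (e11_id R) 0 0 = 0.
      have := Yorth 1 0; rewrite inner_left_metric !(mxE, vec3E) /cz /e11_id vec3E /=.
      by rewrite oppr0 expR0; lra.
    have Y1 : Y (e11_id R) 0 1 = 0.
      have := Yorth 0 1; rewrite inner_left_metric !(mxE, vec3E) /cz /e11_id vec3E /=.
      by rewrite oppr0 expR0; lra.
    (* A right-invariant field is determined by its value at the identity, here [(0, 0, c)]. *)
    rewrite -{1}[p]e11_mul1e Yinv mulmx_jacobian_right_translation Y0 Y1.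
    rewrite scale_right_field; apply/rowP; elim/ord3P; rewrite !vec3E /=.
    + by rewrite /cz /e11_id vec3E expR0 /cx; ring.
    + by rewrite /cz /e11_id vec3E oppr0 expR0 /cy; ring.
    + by [].
  move=> [c YE]; have {YE}-> : Y = right_field 0 0 c.
    by apply/funext => p; rewrite YE scale_right_field.
  split; first exact: right_invariant_right_field.
  move=> a b; rewrite inner_left_metric !(mxE, vec3E) /=
    [e11_id R 0 0]vec3E [e11_id R 0 1]vec3E; ring.
- move=> Z; rewrite g_nuE; split.
    move=> [/killing_left_metric [] // a [b [c ->]]].
    (* The value [(a, b, c)] at the identity must be [c V = (0, 0, c)], so [a = b = 0]. *)
    move=> /nabla_right_field_eq0 [] // _; rewrite orth_field_e11_id => ZE.
    exists c => p; rewrite scale_right_field.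
    have := congr1 (fun v : 'rV[R]_3 => v 0 0) ZE.
    have := congr1 (fun v : 'rV[R]_3 => v 0 1) ZE.
    by rewrite !vec3E /= [e11_id R 0 0]vec3E [e11_id R 0 1]vec3E !mulr0 !addr0 => -> ->.
  move=> [c ZE]; have {ZE}-> : Z = right_field 0 0 c.
    by apply/funext => p; rewrite ZE scale_right_field.
  split; first exact: killing_right_field.
  apply/nabla_right_field_eq0 => //; split; first exact: mul0r.
  by rewrite orth_field_e11_id; apply/rowP; elim/ord3P;
    rewrite !vec3E /= ?[e11_id R 0 0]vec3E ?[e11_id R 0 1]vec3E; ring.
Qed.
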